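(* Let $q$ be a prime power and let $\mathbb{F}_q$ be the field with $q$ elements. For $n\geq 2$ the number $p_n$ of $\mathbb{F}_q$-automorphisms of degree $n$ of the polynomial algebra $\mathbb{F}_q[x,y]$ satisfies the inequalities \[ (q-1)^3(q+1)^2q^{n+1}\leq p_n\leq (q-1)^3(q+1)^2q^{n+1}+(\log_2 n)^{\log_2 n}q^{n/2+8}. \] For a fixed $q$ and any $\varepsilon>0$, \[ p_n=(q-1)^3(q+1)^2q^{n+1}+\mathcal{O}(q^{n(1/2+\varepsilon)})\qquad (n\to\infty). \]
   Context: An automorphism $\varphi$ of $\mathbb{F}_q[x,y]$ is written $\varphi=(f,g)$, meaning $f=\varphi(x)$, $g=\varphi(y)$; all automorphisms are $\mathbb{F}_q$-algebra automorphisms. The degree of $\varphi=(f,g)$ is $\deg(\varphi)=\max\{\deg(f),\deg(g)\}$, where $\deg$ of a polynomial is its total degree. *)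

(* Defs.v *)
From HB Require Import structures.
From mathcomp Require Import all_boot all_order all_algebra.
From mathcomp Require Import finmap mpoly.
From mathcomp Require Import boolp classical_sets functions cardinality.
From mathcomp Require Import reals exp.

Set Implicit Arguments.
Unset Strict Implicit.
Unset Printing Implicit Defensive.

Import GRing.Theory.
Local Open Scope classical_set_scope.
Local Open Scope ring_scope.
Local Open Scope fset_scope.

Definition is_alg_automorphism (K : pzRingType) (A : lalgType K)
    (phi : A -> A) : Prop :=
  [/\ linear phi, monoid_morphism phi & bijective phi].

(* [msize p] is the total degree plus one for [p != 0]. *)
Definition tdeg (F : fieldType) (p : {mpoly F[2]}) : nat := (msize p).-1.

Definition end_degree (F : fieldType)
    (phi : {mpoly F[2]} -> {mpoly F[2]}) : nat :=
  maxn (tdeg (phi 'X_0)) (tdeg (phi 'X_1)).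

Definition automorphisms_of_degree (F : fieldType) (n : nat) :
    set ({mpoly F[2]} -> {mpoly F[2]}) :=
  [set phi | is_alg_automorphism phi /\ end_degree phi = n].

Arguments automorphisms_of_degree F n : clear implicits.

(* [fset_set] maps an infinite set to the empty one, so a positive lower bound
   on this number implies that the set is finite. *)
Definition num_automorphisms (F : finFieldType) (n : nat) : nat :=
  #|` fset_set (automorphisms_of_degree F n)|.

Definition log2 (R : realType) (x : R) : R := ln x / ln 2.

(* Main.v *)
(** An automorphism is a pair (X, Y) of polynomials generating k[x, y]. The
    theorem of Jung and van der Kulk says that if deg X >= deg Y and deg X > 1,
    then deg X = d deg Y and X - c Y^d has smaller degree for some constant c.
    Hence a pair with deg X = n > deg Y = b is obtained uniquely from a pair with
    deg X' <= b = deg Y by adding h(Y) to X', where h has degree n/b and no terms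
    of degree < 2. The case b = 1 gives the main term exactly; for 1 < b < n the
    factor q^(n/b + b) is at most q^(n/2 + 2), and the recursion visits at most as
    many cases as there are ordered factorizations of n, whose number is at most
    L^L, where L = trunc_log 2 n bounds the number of prime factors of n.

    The proof of the Jung-van der Kulk theorem works in every characteristic. Let
    v be minus the total degree on k(u, v), and write (X, Y) for the automorphism,
    so that f(X, Y) = u for some f. If the leading forms of f cancel at (X, Y),
    pass to the monomial chart z, w = X^t Y^-s - c in which they do. The quantity
    v({z, w}) - v(z) - v(w) - 1, where {,} is the Jacobian, is a nonnegative
    integer, invariant under monomial changes of coordinates, and it drops by v(w)
    when w is recentred at a residue; unlike a different exponent it is insensitive
    to inseparability. It therefore bounds the cancellation in f(X, Y) linearly in
    the length of the leading edge of f, and the bound is incompatible with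
    v(u) = -1 unless one of the two degrees divides the other. *)

Require Import Defs.
From HB Require Import structures.
From mathcomp Require Import all_boot all_order all_algebra.
From mathcomp Require Import zify ring.
From mathcomp Require mpoly.

Module JungVanDerKulk.
Import mpoly.
Set Implicit Arguments.
Unset Strict Implicit.
Unset Printing Implicit Defensive.
Import Order.TTheory GRing.Theory Num.Theory.
Local Open Scope ring_scope.

(** * Cancellation bounds for valuations with a Jacobian bracket *)

(** The lowest nonzero coefficient of [q] is only multiplied by the constant term of [p]: a factor
    that is a unit at 0 leaves the order of vanishing unchanged. *)
Lemma coef_mul_neq0 (k : fieldType) (p q : {poly k}) :
  p`_0 != 0 -> q != 0 -> exists2 i, (i < size q)%N & (p * q)`_i != 0.
Proof.
move=> p0 q0.
have exq : exists i, q`_i != 0 by exists (size q).-1; rewrite -lead_coefE lead_coef_eq0.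
case: (ex_minnP exq) => i qi min_i; exists i.
  by rewrite ltnNge; apply: contra qi => /(nth_default 0) ->.
rewrite coefM big_ord_recl subn0 big1 ?addr0 ?mulf_neq0 // => j _.
apply/eqP; rewrite mulf_eq0; apply/orP; right; apply: contraT => /min_i.
by rewrite lift0; have := ltn_ord j; lia.
Qed.

Section Bivariate.
Variables (k : fieldType) (K : fieldType) (iota : {rmorphism k -> K}).

Definition ev1 (y : K) (p : {poly k}) : K := (map_poly iota p).[y].
Definition ev (x y : K) (F : {poly {poly k}}) : K := (map_poly (ev1 y) F).[x].

HB.instance Definition _ y := GRing.RMorphism.copy (ev1 y) (horner_eval y \o map_poly iota).
HB.instance Definition _ x y := GRing.RMorphism.copy (ev x y) (horner_eval x \o map_poly (ev1 y)).

Lemma ev1X y : ev1 y 'X = y.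
Proof. by rewrite /ev1 map_polyX hornerX. Qed.

Lemma ev1C y c : ev1 y c%:P = iota c.
Proof. by rewrite /ev1 map_polyC hornerC. Qed.

Lemma ev1Z y c p : ev1 y (c *: p) = iota c * ev1 y p.
Proof. by rewrite -mul_polyC rmorphM /= ev1C. Qed.

Lemma evX x y : ev x y 'X = x.
Proof. by rewrite /ev map_polyX hornerX. Qed.

Lemma evC x y p : ev x y p%:P = ev1 y p.
Proof. by rewrite /ev map_polyC hornerC. Qed.

Lemma evE x y F : ev x y F =
  \sum_(i < size F) \sum_(j < size F`_i) iota F`_i`_j * (x ^+ i * y ^+ j).
Proof.
rewrite -[in LHS](coefK F) poly_def rmorph_sum; apply: eq_bigr => i _.
rewrite -mul_polyC rmorphM /= evC rmorphXn /= evX.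
rewrite -[in LHS](coefK F`_i) poly_def rmorph_sum big_distrl; apply: eq_bigr => j _ /=.
by rewrite ev1Z rmorphXn /= ev1X -mulrA [in LHS](mulrC (y ^+ j)).
Qed.

(** [(I, J)] is an endpoint of the edge of the Newton polygon of [F] in direction [(s, t)]. Breaking
    ties by the largest [J] makes [J] control the length of the edge. *)
Lemma exists_min_monomial (s t : int) (F : {poly {poly k}}) : F != 0 ->
  exists I J : nat, F`_I`_J != 0 /\ forall i j : nat, F`_i`_j != 0 ->
    s * I%:Z + t * J%:Z <= s * i%:Z + t * j%:Z
    /\ (s * I%:Z + t * J%:Z = s * i%:Z + t * j%:Z -> (j <= J)%N).
Proof.
move=> F0.
pose n := maxn (size F) (\max_(i < size F) size (F`_i)%R)%N.
have supp i j : F`_i`_j != 0 -> (i < n)%N /\ (j < n)%N.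
  move=> Fij.
  have ltj : (j < size (F`_i)%R)%N.
    by rewrite ltnNge; apply: contra Fij => /(nth_default 0) ->.
  have lti : (i < size F)%N.
    rewrite ltnNge; apply: contra Fij => /(nth_default 0) ->.
    by rewrite coef0.
  rewrite !leq_max lti; split=> //; apply/orP; right.
  by apply: leq_trans ltj (leq_bigmax (Ordinal lti)).
have lF : F`_(size F).-1`_(size F`_(size F).-1).-1 != 0.
  by rewrite -lead_coefE lead_coef_eq0 -lead_coefE lead_coef_eq0.
have [ln1 ln2] := supp _ _ lF.
pose P := [pred m : 'I_n * 'I_n | F`_m.1`_m.2 != 0].
pose wt (m : 'I_n * 'I_n) : int := s * m.1%:Z + t * m.2%:Z.
have P0 : P (Ordinal ln1, Ordinal ln2) by [].
case: (arg_minP wt P0) => m1 Pm1 min1.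
pose Q := [pred m | P m & wt m == wt m1].
have Q1 : Q m1 by rewrite /Q /= eqxx andbT.
case: (arg_maxnP (fun m : 'I_n * 'I_n => m.2 : nat) Q1) => m2 /andP[Pm2 /eqP wm2] max2.
exists m2.1, m2.2; split=> // i j Fij.
have [lti ltj] := supp _ _ Fij.
rewrite -/(wt m2) wm2; split; first exact: (min1 (Ordinal lti, Ordinal ltj)).
move=> wE; apply: (max2 (Ordinal lti, Ordinal ltj)).
by rewrite /Q /= Fij -[X in X == _]wE eqxx.
Qed.

(** On the level of [(I, J)] no other monomial of the support is sent to the exponent [h I J], so
    its coefficient cannot cancel. *)
Lemma sum_monomials_neq0 (I J : nat) (F : {poly {poly k}})
  (T : eqType) (g : nat -> nat -> T) (h : nat -> nat -> nat) :
  F`_I`_J != 0 ->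
  (forall i j : nat, F`_i`_j != 0 -> g i j = g I J -> h i j = h I J -> i = I /\ j = J) ->
  \sum_(i < size F) \sum_(j < size F`_i | g i j == g I J)
    (F`_i`_j *: 'X^(h i j)) != 0 :> {poly k}.
Proof.
move=> FIJ inj.
have ltJ : (J < size (F`_I)%R)%N.
  by rewrite ltnNge; apply: contra FIJ => /(nth_default 0) ->.
have ltI : (I < size F)%N.
  by rewrite ltnNge; apply: contra FIJ => /(nth_default 0) ->; rewrite coef0.
apply: contraNneq FIJ => /(congr1 (fun p : {poly k} => p`_(h I J))).
rewrite coef0 coef_sum (bigD1 (Ordinal ltI)) //= coef_sum.
rewrite (bigD1 (Ordinal ltJ)) //= coefZ coefXn eqxx mulr1.
rewrite big1 ?addr0 => [|j /andP[/eqP gE neq]]; last first.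
  rewrite coefZ coefXn; case: eqP => [hE|]; last by rewrite mulr0.
  case: (eqVneq F`_I`_j 0) => [->|Fij]; first by rewrite mul0r.
  have [_ jE] := inj _ _ Fij gE (esym hE).
  by case/eqP: neq; apply: val_inj.
rewrite big1 ?addr0 => [->//|i neq].
rewrite coef_sum big1 // => j /eqP gE.
rewrite coefZ coefXn; case: eqP => [hE|]; last by rewrite mulr0.
case: (eqVneq F`_i`_j 0) => [->|Fij]; first by rewrite mul0r.
have [iE _] := inj _ _ Fij gE (esym hE).
by case/eqP: neq; apply: val_inj.
Qed.

(** [val] is a discrete valuation on a rational function field in two variables
    over [k], such as minus the degree, with junk value at [0], and [br] is the
    Jacobian bracket. [residue] says that [k] is algebraically closed in the
    residue field. *)
Variables (val : K -> int) (br : K -> K -> K).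
Hypothesis valM : forall x y : K, x != 0 -> y != 0 -> val (x * y) = val x + val y.
Hypothesis valD : forall x y : K, x != 0 -> y != 0 -> x + y != 0 ->
  Num.min (val x) (val y) <= val (x + y).
Hypothesis val_iota : forall c : k, c != 0 -> val (iota c) = 0.

(** Gives 0 infinite valuation, overriding the junk value of [val]. *)
Definition ge_val (n : int) (x : K) := (x == 0) || (n <= val x).

Hypothesis residue : forall (p : {poly k}) (W : K), p != 0 -> W != 0 -> val W = 0 ->
  ge_val 1 (ev1 W p) -> exists c, ge_val 1 (W - iota c).
Hypothesis brDl : forall x y u, br (x + y) u = br x u + br y u.
Hypothesis brMl : forall x y u, br (x * y) u = x * br y u + y * br x u.
Hypothesis brC : forall x y, br x y = - br y x.
Hypothesis brxx : forall x, br x x = 0.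
Hypothesis br_iota : forall c u, br (iota c) u = 0.
Hypothesis val_br : forall x y, br x y != 0 -> val x + val y + 1 <= val (br x y).

(** * Rules for the valuation and the bracket *)

Lemma val1 : val 1 = 0.
Proof. by rewrite -(rmorph1 iota) val_iota ?oner_neq0. Qed.

Lemma valN x : x != 0 -> val (- x) = val x.
Proof.
move=> x0; rewrite -mulN1r valM ?oppr_eq0 ?oner_neq0 //.
by rewrite -(rmorphN1 iota) val_iota ?oppr_eq0 ?oner_neq0 // add0r.
Qed.

Lemma valV x : x != 0 -> val x^-1 = - val x.
Proof.
by move=> x0; apply: (addrI (val x)); rewrite -valM ?invr_eq0 // divff // val1 subrr.
Qed.

Lemma valX x (n : nat) : x != 0 -> val (x ^+ n) = val x * n%:Z.
Proof.
move=> x0; elim: n => [|n IH]; first by rewrite expr0 val1 mulr0.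
by rewrite exprS valM ?expf_neq0 // IH; lia.
Qed.

Lemma valXz x (n : int) : x != 0 -> val (x ^ n) = val x * n.
Proof.
move=> x0; case: (intP n) => [|m|m]; first by rewrite expr0z val1 mulr0.
  by rewrite -exprnP valX.
by rewrite -exprnN valV ?expf_neq0 // valX //; lia.
Qed.

Lemma ge_valD n x y : ge_val n x -> ge_val n y -> ge_val n (x + y).
Proof.
case: (eqVneq x 0) => [->|x0]; first by rewrite add0r.
case: (eqVneq y 0) => [->|y0]; first by rewrite addr0.
rewrite /ge_val (negPf x0) (negPf y0) /= => hx hy.
case: (eqVneq (x + y) 0) => //= xy0.
by apply: le_trans (valD x0 y0 xy0); rewrite le_min hx.
Qed.

Lemma ge_val_sum n I (r : seq I) (P : pred I) (f : I -> K) :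
  (forall i, P i -> ge_val n (f i)) -> ge_val n (\sum_(i <- r | P i) f i).
Proof.
by move=> h; apply: (big_ind (ge_val n)) => //; [rewrite /ge_val eqxx|exact: ge_valD].
Qed.

Lemma ge_valM m n x y : ge_val m x -> ge_val n y -> ge_val (m + n) (x * y).
Proof.
rewrite /ge_val mulf_eq0; case: (eqVneq x 0) => //= x0; case: (eqVneq y 0) => //= y0.
by rewrite valM //; exact: lerD.
Qed.

Lemma ge_val_iota c : ge_val 0 (iota c).
Proof. by rewrite /ge_val fmorph_eq0; case: eqP => //= /eqP c0; rewrite val_iota. Qed.

(** The ultrametric inequality is applied to [x + y] and then to [x = (x + y) - y]. *)
Lemma val_dominant x y : x != 0 -> ge_val (val x + 1) y ->
  x + y != 0 /\ val (x + y) = val x.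
Proof.
move=> x0; rewrite /ge_val; case: (eqVneq y 0) => [->|y0] /= hy; first by rewrite addr0.
have xy0 : x + y != 0.
  apply/eqP => /eqP; rewrite addr_eq0 => /eqP xE.
  by move: hy; rewrite xE valN //; lia.
split=> //; have h1 := valD x0 y0 xy0.
have Ny0 : - y != 0 by rewrite oppr_eq0.
have h2 := valD xy0 Ny0; rewrite addrK valN // in h2; have {}h2 := h2 x0.
have lt_xy : val x < val y by apply: lt_le_trans hy; rewrite ltrDl.
move: h1 h2; rewrite !ge_min => /orP[h1|h1] /orP[h2|h2].
- by apply: le_anti; rewrite h1 h2.
- by move: lt_xy; rewrite ltNge h2.
- by move: (lt_le_trans lt_xy h1); rewrite ltNge h2.
- by move: lt_xy; rewrite ltNge h2.
Qed.

Lemma brDr x y u : br u (x + y) = br u x + br u y.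
Proof. by rewrite brC brDl opprD -!brC. Qed.

Lemma brMr x y u : br u (x * y) = x * br u y + y * br u x.
Proof. by rewrite brC brMl opprD -!mulrN -!brC. Qed.

Lemma br_iotar c u : br u (iota c) = 0.
Proof. by rewrite brC br_iota oppr0. Qed.

Lemma brXzl x (n : int) u : x != 0 -> br (x ^ n) u = n%:~R * x ^ n / x * br x u.
Proof.
move=> x0.
have br1 : br 1 u = 0 by rewrite -(rmorph1 iota) br_iota.
have brX (m : nat) : br (x ^+ m) u = m%:R * x ^+ m / x * br x u.
  elim: m => [|m IH]; first by rewrite expr0 br1 !mul0r.
  by rewrite exprS brMl IH -[m.+1%:R]natr1; field.
case: (intP n) => [|m|m]; first by rewrite expr0z br1 !mul0r.
  by rewrite -exprnP brX.
rewrite -exprnN; have xm0 : x ^+ m.+1 != 0 by rewrite expf_neq0.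
(* Negative powers: the Leibniz rule is applied to the product of [x ^+ m.+1] and its inverse, whose
   bracket is zero. *)
apply: (mulfI xm0); apply: (addIr ((x ^+ m.+1)^-1 * br (x ^+ m.+1) u)).
rewrite -brMl divff // br1 brX rmorphN /= -pmulrn.
by field; rewrite x0.
Qed.

Lemma brXzr x (n : int) u : x != 0 -> br u (x ^ n) = n%:~R * x ^ n / x * br u x.
Proof. by move=> x0; rewrite brC brXzl // (brC u x) mulrN. Qed.

(** The exponent matrix has determinant -1, so the logarithmic form [br x y / (x * y)] only changes
    sign. *)
Lemma br_monomials (x y : K) (a b s t : int) : x != 0 -> y != 0 -> a * s + b * t = 1 ->
  br (x ^ a * y ^ b) (x ^ t * y ^ (- s)) =
  - (x ^ a * y ^ b * (x ^ t * y ^ (- s)) / (x * y) * br x y).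
Proof.
move=> x0 y0 bez.
rewrite brMl !brMr !brXzl // !brXzr // !brxx (brC y x).
transitivity (- ((a * s + b * t)%:~R * (x ^ a * y ^ b * (x ^ t * y ^ (- s)) / (x * y) * br x y))).
  by rewrite rmorphD !rmorphM rmorphN /=; field; rewrite x0 y0.
by rewrite bez mul1r.
Qed.

Lemma monomial_change (x y : K) (a b s t : int) (i j : nat) : x != 0 -> y != 0 ->
  a * s + b * t = 1 ->
  x ^+ i * y ^+ j = (x ^ a * y ^ b) ^ (s * i%:Z + t * j%:Z)
                  * (x ^ t * y ^ (- s)) ^ (b * i%:Z - a * j%:Z).
Proof.
move=> x0 y0 bez; rewrite (exprnP x) (exprnP y) !expfzMl !exprz_exp.
rewrite mulrACA -!expfzDr //; congr (_ * _);
  by congr (_ ^ _); rewrite -[LHS]mul1r -bez; ring.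
Qed.

Lemma monomial_bound (F : {poly {poly k}}) (f : nat -> nat -> int) :
  exists N : nat, forall i j : nat, F`_i`_j != 0 -> 0 <= f i j + N%:Z.
Proof.
exists (\max_(i < size F) \max_(j < size (F`_i)%R) `|f i j|%N)%N => i j Fij.
have ltj : (j < size (F`_i)%R)%N.
  by rewrite ltnNge; apply: contra Fij => /(nth_default 0) ->.
have lti : (i < size F)%N.
  by rewrite ltnNge; apply: contra Fij => /(nth_default 0) ->; rewrite coef0.
have : (`|f i j| <= \max_(i < size F) \max_(j < size (F`_i)%R) `|f i j|)%N.
  rewrite (bigD1 (Ordinal lti)) //= leq_max; apply/orP; left.
  by rewrite (bigD1 (Ordinal ltj)) //= leq_max leqnn.
lia.
Qed.

(** The chart [z = x^a y^b], [W = x^t y^-s] has inverse [x = z^s W^b],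
    [y = z^t W^-a], so the monomial [x^i y^j] becomes [z^(wt i j) W^(ex i j)]. *)
Section Chart.
Variables (s t a b : int).
Hypothesis bezout : a * s + b * t = 1.
Let wt (i j : nat) : int := s * i%:Z + t * j%:Z.
Let ex (i j : nat) : int := b * i%:Z - a * j%:Z.

(** The strict transform of [F] in [z] and [w = W - c]: the power [z ^ om] is divided out, and
    [W ^ N] clears the negative powers of [W]. The absolute values are harmless when [om] is the
    least weight and [N] is large. *)
Definition chart_poly (F : {poly {poly k}}) (om : int) (N : nat) (c : k) : {poly {poly k}} :=
  \sum_(i < size F) \sum_(j < size F`_i)
    'X^(`|(wt i j - om)%R|%N) * (F`_i`_j *: ('X + c%:P) ^+ `|(ex i j + N%:Z)%R|%N)%:P.

(** The monomials of least weight, as a polynomial in [W] divided by [W^l]. *)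
Definition edge_poly (F : {poly {poly k}}) (om l : int) : {poly k} :=
  \sum_(i < size F) \sum_(j < size F`_i | wt i j == om)
    F`_i`_j *: 'X^(`|(ex i j - l)%R|%N).

Lemma ev_chart_poly (x y : K) (F : {poly {poly k}}) (om : int) (N : nat) (c : k) :
  x != 0 -> y != 0 ->
  (forall i j : nat, F`_i`_j != 0 -> om <= wt i j) ->
  (forall i j : nat, F`_i`_j != 0 -> 0 <= ex i j + N%:Z) ->
  let z := x ^ a * y ^ b in let W := x ^ t * y ^ (- s) in
  z ^ om * ev z (W - iota c) (chart_poly F om N c) = W ^+ N * ev x y F.
Proof.
move=> x0 y0 hom hN z W.
have z0 : z != 0 by rewrite mulf_neq0 // expfz_neq0.
have W0 : W != 0 by rewrite mulf_neq0 // expfz_neq0.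
rewrite [in RHS]evE rmorph_sum !big_distrr; apply: eq_bigr => i _ /=.
rewrite rmorph_sum !big_distrr; apply: eq_bigr => j _ /=.
rewrite rmorphM rmorphXn /= evX evC ev1Z rmorphXn rmorphD /= ev1X ev1C subrK.
case: (eqVneq F`_i`_j 0) => [->|Fij]; first by rewrite rmorph0 !mul0r !mulr0.
rewrite (monomial_change _ _ x0 y0 bezout) -/z -/W -/(wt i j) -/(ex i j).
have -> : z ^+ `|(wt i j - om)%R|%N = z ^ (wt i j) / z ^ om.
  by rewrite (exprnP z) gez0_abs ?subr_ge0 ?hom // expfzDr // invr_expz.
have -> : W ^+ `|(ex i j + N%:Z)%R|%N = W ^ (ex i j) * W ^+ N.
  by rewrite (exprnP W) gez0_abs ?hN // expfzDr.
have zom : z ^ om != 0 by rewrite expfz_neq0.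
by field.
Qed.

(** At [z = 0] only the monomials of weight [om] survive. *)
Lemma chart_poly_coef0 (F : {poly {poly k}}) (om l : int) (N : nat) (c : k) :
  (forall i j : nat, F`_i`_j != 0 -> wt i j = om -> l <= ex i j) ->
  0 <= l + N%:Z ->
  (chart_poly F om N c)`_0 =
  ('X + c%:P) ^+ `|(l + N%:Z)%R|%N * (edge_poly F om l \Po ('X + c%:P)).
Proof.
move=> hl hN; rewrite coef_sum /edge_poly.
rewrite raddf_sum mulr_sumr; apply: eq_bigr => i _ /=.
rewrite coef_sum raddf_sum mulr_sumr [RHS]big_mkcond; apply: eq_bigr => j _ /=.
rewrite coefMC coefXn eq_sym absz_eq0 subr_eq0.
case: eqP => wij; last by rewrite mul0r.
case: (eqVneq F`_i`_j 0) => [->|Fij]; first by rewrite !scale0r comp_poly0 !mulr0.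
rewrite mul1r comp_polyZ comp_Xn_poly -scalerAr -exprD; congr (_ *: _ ^+ _).
by move: (hl _ _ Fij wij) hN; move: (ex i j) => u; lia.
Qed.

(** Weight and [ex] are unimodular coordinates on the exponents, so distinct monomials of the edge
    have distinct powers of [W]. *)
Lemma edge_poly_neq0 (F : {poly {poly k}}) (l : int) (I J : nat) : F`_I`_J != 0 ->
  (forall i j : nat, F`_i`_j != 0 -> wt i j = wt I J -> l <= ex i j) ->
  edge_poly F (wt I J) l != 0.
Proof.
move=> FIJ hl; apply: (@sum_monomials_neq0 I J F _ wt (fun i j => `|(ex i j - l)%R|%N)) => //.
move=> i j Fij wE eE.
have {}eE : ex i j = ex I J.
  by move: (hl _ _ Fij wE) (hl _ _ FIJ erefl) eE; move: (ex i j) (ex I J) => u v; lia.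
have iE : i%:Z = I%:Z.
  by rewrite -[LHS]mul1r -[RHS]mul1r -bezout;
     transitivity (a * wt i j + t * ex i j); [rewrite /wt /ex; ring|rewrite wE eE /wt /ex; ring].
have jE : j%:Z = J%:Z.
  by rewrite -[LHS]mul1r -[RHS]mul1r -bezout;
     transitivity (b * wt i j - s * ex i j); [rewrite /wt /ex; ring|rewrite wE eE /wt /ex; ring].
by split; [case: iE|case: jE].
Qed.

Lemma size_edge_poly (F : {poly {poly k}}) (om l : int) (e : nat) :
  (forall i j : nat, F`_i`_j != 0 -> wt i j = om -> l <= ex i j <= l + e%:Z) ->
  (size (edge_poly F om l) <= e.+1)%N.
Proof.
move=> hl; apply: (leq_trans (size_sum _ _ _)); apply/bigmax_leqP => i _.
apply: (leq_trans (size_sum _ _ _)); apply/bigmax_leqP => j /eqP wij.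
case: (eqVneq F`_i`_j 0) => [->|Fij]; first by rewrite scale0r size_poly0.
apply: leq_trans (size_scale_leq _ _) _; rewrite size_polyXn ltnS.
by move: (hl _ _ Fij wij); move: (ex i j) => u; lia.
Qed.

(** In this chart [val z = h > 0] and [val W = 0], so each monomial off the edge contributes a
    remainder of positive valuation. *)
Lemma ev1_edge_poly (x y : K) (F : {poly {poly k}}) (h l : int) (I J : nat) :
  x != 0 -> y != 0 -> 0 < h -> val x = h * s -> val y = h * t ->
  (forall i j : nat, F`_i`_j != 0 -> wt I J <= wt i j) ->
  (forall i j : nat, F`_i`_j != 0 -> wt i j = wt I J -> l <= ex i j) ->
  let z := x ^ a * y ^ b in let W := x ^ t * y ^ (- s) in
  exists2 r, ge_val 1 r & ev x y F = z ^ wt I J * W ^ l * (ev1 W (edge_poly F (wt I J) l) + r).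
Proof.
move=> x0 y0 h0 vx vy hom hl z W.
have z0 : z != 0 by rewrite mulf_neq0 // expfz_neq0.
have W0 : W != 0 by rewrite mulf_neq0 // expfz_neq0.
have vz : val z = h.
  rewrite valM ?expfz_neq0 // !valXz // vx vy.
  by rewrite -[RHS]mulr1 -bezout; ring.
have vW : val W = 0.
  by rewrite valM ?expfz_neq0 // !valXz // vx vy; ring.
exists (\sum_(i < size F) \sum_(j < size F`_i | wt i j != wt I J)
  iota F`_i`_j * (z ^ (wt i j - wt I J) * W ^ (ex i j - l))).
  apply: ge_val_sum => i _; apply: ge_val_sum => j wij.
  case: (eqVneq F`_i`_j 0) => [->|Fij]; first by rewrite rmorph0 mul0r /ge_val eqxx.
  rewrite -[1]add0r; apply: ge_valM; first exact: ge_val_iota.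
  rewrite /ge_val valM ?expfz_neq0 // !valXz // vz vW mul0r addr0; apply/orP; right.
  have hh : 1 <= wt i j - wt I J.
    by rewrite -[1]add0r lezD1 subr_gt0 lt_neqAle eq_sym wij hom.
  by rewrite -[1]mulr1; apply: ler_pM.
rewrite /edge_poly rmorph_sum -big_split mulr_sumr evE; apply: eq_bigr => i _ /=.
rewrite rmorph_sum mulrDr !mulr_sumr (bigID (fun j : 'I_ _ => wt i j == wt I J)) /=.
have zI : z ^ wt I J != 0 by rewrite expfz_neq0.
have Wl : W ^ l != 0 by rewrite expfz_neq0.
have key (j : 'I_(size F`_i)) : iota F`_i`_j * (x ^+ i * y ^+ j) =
  z ^ wt I J * W ^ l * (iota F`_i`_j * (z ^ (wt i j - wt I J) * W ^ (ex i j - l))).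
  rewrite (monomial_change _ _ x0 y0 bezout) -/z -/W -/(wt i j) -/(ex i j).
  move: (wt i j) (wt I J) (ex i j) zI => u v m zI.
  by rewrite !expfzDr // -!invr_expz; field; rewrite zI Wl.
congr (_ + _); apply: eq_bigr => j wij; last exact: key.
rewrite key; congr (_ * _); rewrite (eqP wij) subrr expr0z mul1r.
rewrite ev1Z rmorphXn /= ev1X.
case: (eqVneq F`_i`_j 0) => [->|Fij]; first by rewrite rmorph0 !mul0r.
by rewrite (exprnP W) gez0_abs // subr_ge0 hl //; apply/eqP.
Qed.

(** Either the terms of least weight do not cancel at [(x, y)], or [W] has a residue
    [c] and the new pair [(z, W - c)] has a discrepancy smaller by [val w]. *)
Lemma blowup_step (x y : K) (F : {poly {poly k}}) (h l : int) (I J e : nat) :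
  x != 0 -> y != 0 -> br x y != 0 -> 0 < h -> val x = h * s -> val y = h * t ->
  F`_I`_J != 0 ->
  (forall i j : nat, F`_i`_j != 0 -> wt I J <= wt i j) ->
  (forall i j : nat, F`_i`_j != 0 -> wt i j = wt I J -> l <= ex i j <= l + e%:Z) ->
  ev x y F != 0 /\ val (ev x y F) = h * wt I J \/
  exists (c : k) (G : {poly {poly k}}) (e' : nat) (u : K),
    let z := x ^ a * y ^ b in let w := x ^ t * y ^ (- s) - iota c in
  [/\ [/\ z != 0, w != 0, val z = h & 0 < val w], G`_0`_e' != 0 /\ (e' <= e)%N,
      br z w != 0 /\ val (br z w) = val (br x y) - val x - val y + h
    & [/\ u != 0, val u = h * wt I J & ev x y F = u * ev z w G]].
Proof.
move=> x0 y0 xy0 h0 vx vy FIJ hom hl.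
have hl1 i j : F`_i`_j != 0 -> wt i j = wt I J -> l <= ex i j.
  by move=> Fij /(hl _ _ Fij) /andP[].
have [r r1 FE] := ev1_edge_poly x0 y0 h0 vx vy hom hl1.
set z := x ^ a * y ^ b in FE *; set W := x ^ t * y ^ (- s) in FE *.
have z0 : z != 0 by rewrite mulf_neq0 // expfz_neq0.
have W0 : W != 0 by rewrite mulf_neq0 // expfz_neq0.
have vz : val z = h.
  rewrite valM ?expfz_neq0 // !valXz // vx vy.
  by rewrite -[RHS]mulr1 -bezout; ring.
have vW : val W = 0.
  by rewrite valM ?expfz_neq0 // !valXz // vx vy; ring.
have Q0 := edge_poly_neq0 FIJ hl1; set Q := edge_poly _ _ _ in FE Q0.
have [Q1|Q1] := boolP (ge_val 1 (ev1 W Q)); last first.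
  left; have Qge : ge_val 0 (ev1 W Q).
    rewrite -(coefK Q) poly_def rmorph_sum; apply: ge_val_sum => i _ /=.
    rewrite ev1Z rmorphXn /= ev1X -[0]addr0; apply: ge_valM; first exact: ge_val_iota.
    by rewrite /ge_val valX // vW mul0r lexx orbT.
  move: Q1 Qge; rewrite /ge_val negb_or => /andP[QW0 nQ1]; rewrite (negPf QW0) /= => QW1.
  have vQ : val (ev1 W Q) = 0.
    by apply: le_anti; rewrite QW1 andbT leNgt gtz0_ge1.
  have [] := @val_dominant (ev1 W Q) r QW0; first by rewrite vQ add0r.
  rewrite vQ FE => Qr0 vQr; rewrite !mulf_neq0 ?expfz_neq0 //; split=> //.
  by rewrite !valM ?mulf_neq0 ?expfz_neq0 // !valXz // vz vW vQr; ring.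
right; have [c c1] := residue Q0 W0 vW Q1.
have brE : br z (W - iota c) = - (z * W / (x * y) * br x y).
  by rewrite -(rmorphN iota) brDr br_iotar addr0 br_monomials.
have brzw : br z (W - iota c) != 0.
  rewrite brE oppr_eq0; apply: mulf_neq0 => //.
  by apply: mulf_neq0; [exact: mulf_neq0 | rewrite invr_eq0 mulf_neq0].
have w0 : W - iota c != 0.
  apply: contraNneq brzw => wE; rewrite wE.
  by have := br_iotar 0 z; rewrite rmorph0 => ->.
(* [W] has valuation 0, hence a nonzero residue; this makes the power of ['X + c%:P] below a unit at
   0. *)
have c0 : c != 0.
  apply/eqP => cE; move: c1; rewrite cE rmorph0 subr0 /ge_val (negPf W0) vW.
  by [].
have [N hN lN] : exists2 N : nat,
    (forall i j : nat, F`_i`_j != 0 -> 0 <= ex i j + N%:Z) & 0 <= l + N%:Z.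
  have [N hN] := monomial_bound F ex; exists (N + `|l|)%N; last by clear; lia.
  by move=> i j /hN; move: (ex i j); clear; lia.
have Qc0 : Q \Po ('X + c%:P) != 0.
  by rewrite -size_poly_eq0 -[c%:P]opprK -polyCN size_comp_poly2 ?size_XsubC // size_poly_eq0.
have Xc0 : (('X + c%:P) ^+ `|(l + N%:Z)%R|%N)`_0 != 0.
  rewrite -horner_coef0 horner_exp hornerD hornerX hornerC add0r.
  by rewrite expf_neq0.
(* The order of the strict transform along [z = 0] is the multiplicity of [c] as a root of the edge
   polynomial, hence at most the edge length. *)
have [e' lte' Ge'] := coef_mul_neq0 Xc0 Qc0.
exists c, (chart_poly F (wt I J) N c), e', (z ^ wt I J / W ^+ N).
have WN0 : W ^+ N != 0 by rewrite expf_neq0.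
split.
- by split=> //; move: c1; rewrite /ge_val (negPf w0) /= gtz0_ge1.
- rewrite (chart_poly_coef0 _ hl1) //; split=> //.
  rewrite -ltnS; apply: leq_trans lte' _.
  rewrite -[c%:P]opprK -polyCN size_comp_poly2 ?size_XsubC //.
  exact: size_edge_poly hl.
- have xyV0 : (x * y)^-1 != 0 by rewrite invr_eq0 mulf_neq0.
  have zW0 : z * W != 0 by rewrite mulf_neq0.
  have zWxy0 : z * W / (x * y) != 0 by rewrite mulf_neq0.
  split=> //; rewrite brE valN; last by rewrite mulf_neq0.
  rewrite (valM zWxy0 xy0) (valM zW0 xyV0) (valM z0 W0) valV ?mulf_neq0 //.
  rewrite (valM x0 y0).
  by rewrite vz vW; ring.
- split; first by rewrite mulf_neq0 ?invr_eq0 ?expfz_neq0.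
  + by rewrite valM ?valV ?invr_eq0 ?expfz_neq0 // valX // valXz // vz vW; ring.
  + have := ev_chart_poly c x0 y0 hom hN; rewrite -/z -/W => evE'.
    by apply: (mulfI WN0); rewrite -evE' -[in RHS]mulrA [RHS]mulrCA mulVKf.
Qed.

End Chart.

Lemma int_direction (p q : int) : p != 0 -> exists h s t a b : int,
  [/\ 0 < h, p = h * s, q = h * t & a * s + b * t = 1].
Proof.
move=> p0; have [u [v uv]] := Bezoutz p q.
have g0 : gcdz p q != 0 by rewrite gcdz_eq0 (negPf p0).
exists (gcdz p q), (p %/ gcdz p q)%Z, (q %/ gcdz p q)%Z, u, v.
have pE : p = gcdz p q * (p %/ gcdz p q)%Z by rewrite mulrC divzK // dvdz_gcdl.
have qE : q = gcdz p q * (q %/ gcdz p q)%Z by rewrite mulrC divzK // dvdz_gcdr.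
split=> //; first by rewrite lt_neqAle eq_sym g0.
by apply: (mulfI g0); rewrite mulrDr !mulrA ![_ * u]mulrC ![_ * v]mulrC -!mulrA -pE -qE mulr1.
Qed.

(** Lattice points of equal weight differ by multiples of [(t, -s)], and the multiple is the
    difference of their [ex]. *)
Lemma edge_step (s t a b I J i j : int) : a * s + b * t = 1 ->
  s * i + t * j = s * I + t * J ->
  i = I + t * ((b * i - a * j) - (b * I - a * J)) /\
  j = J - s * ((b * i - a * j) - (b * I - a * J)).
Proof.
move=> bez wE; split.
  transitivity (I + (a * s + b * t) * (i - I) - a * ((s * i + t * j) - (s * I + t * J))).
    by rewrite wE bez subrr; ring.
  by ring.
transitivity (J + (a * s + b * t) * (j - J) - b * ((s * i + t * j) - (s * I + t * J))).
  by rewrite wE bez subrr; ring.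
by ring.
Qed.

(** Induction on the discrepancy [val (br z w) - val z - val w - 1]; the bound is the
    log canonical threshold inequality for the pair formed by [F] and the line [z = 0]. *)
Lemma val_ev_le_ind (n : nat) (z w : K) (F : {poly {poly k}}) (e : nat) :
  z != 0 -> w != 0 -> br z w != 0 -> 0 < val z -> 0 < val w ->
  val (br z w) - val z - val w - 1 < n%:Z -> F`_0`_e != 0 ->
  ev z w F != 0 /\ val (ev z w F) <= e%:Z * (val (br z w) - val z - 1).
Proof.
elim: n z w F e => [|n IH] z w F e z0 w0 zw0 vz vw hn Fe.
  (* The discrepancy is never negative, by [val_br]. *)
  by have := val_br zw0; move: hn; clear; lia.
have F0 : F != 0 by apply: contraNneq Fe => ->; rewrite !coef0.
have [h [s [t [a [b [h0 zE wE bez]]]]]] : exists h s t a b : int,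
    [/\ 0 < h, val z = h * s, val w = h * t & a * s + b * t = 1].
  by apply: int_direction; rewrite gt_eqF.
have s0 : 0 < s by move: vz; rewrite zE pmulr_rgt0.
have t0 : 0 < t by move: vw; rewrite wE pmulr_rgt0.
have [I [J [FIJ min]]] := exists_min_monomial s t F0.
set om := s * I%:Z + t * J%:Z in min.
(* Along the edge the exponent of [w] falls from [J] by [s >= 1] per step, so there are at most [J]
   steps. The monomial [w ^+ e] of [F] bounds the least weight and hence gives [J <= e]. *)
have om_le i j : F`_i`_j != 0 -> om <= s * i%:Z + t * j%:Z by case/min.
have width i j : F`_i`_j != 0 -> s * i%:Z + t * j%:Z = om ->
    b * I%:Z - a * J%:Z <= b * i%:Z - a * j%:Z <= b * I%:Z - a * J%:Z + J%:Z.
  move=> Fij wij; have [_ jJ] := min _ _ Fij; have {}jJ := jJ (esym wij).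
  have [_ jE] := edge_step bez wij.
  move: jE s0 jJ; move: (b * I%:Z - _) (b * i%:Z - _) => u v; clear; nia.
have omE : h * om <= e%:Z * val w.
  have := om_le _ _ Fe; rewrite mulr0 add0r -(ler_pM2l h0) => /le_trans; apply.
  rewrite wE le_eqVlt; apply/orP; left; apply/eqP; ring.
have omJ : J%:Z * val w <= h * om.
  rewrite wE mulrCA ler_pM2l // /om [_ * t]mulrC lerDr.
  by rewrite mulr_ge0 // ltW.
have Je : J%:Z <= e%:Z by rewrite -(ler_pM2r vw) (le_trans omJ).
have hbr := val_br zw0.
have [[Fzw vF]|] := blowup_step bez z0 w0 zw0 h0 zE wE FIJ om_le width.
  split=> //; rewrite vF; apply: le_trans omE _.
  by apply: ler_wpM2l => //; move: hbr; clear; lia.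
move=> [c [G [e' [u [[z'0 w'0 vz' vw'] [Ge' e'J] [br0 brE] [u0 vu FE]]]]]].
move: (z ^ a * w ^ b) (z ^ t * w ^ (- s) - iota c) z'0 w'0 vz' vw' br0 brE FE => z' w'.
move=> z'0 w'0 vz' vw' br0 brE FE.
have [] := IH z' w' G e' z'0 w'0 br0 _ vw' _ Ge'; first by rewrite vz'.
  by rewrite brE vz'; move: hn vw'; clear; lia.
move=> G0 vG; rewrite FE; split; first exact: mulf_neq0.
rewrite valM // vu; move: vG; rewrite brE vz' => vG.
(* The old discrepancy is nonnegative and [e' <= J <= e], so the total is at most [e * val w] plus
   [e] times the discrepancy, which is the claimed bound. *)
move: Je e'J omE omJ hbr vG hn vw; clear.
move: (val z) (val w) (val (br z w)) (val (ev z' w' G)) (h * om) => A B C D E.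
nia.
Qed.

Lemma val_ev_le (z w : K) (F : {poly {poly k}}) (e : nat) :
  z != 0 -> w != 0 -> br z w != 0 -> 0 < val z -> 0 < val w -> F`_0`_e != 0 ->
  ev z w F != 0 /\ val (ev z w F) <= e%:Z * (val (br z w) - val z - 1).
Proof.
move=> z0 w0 zw0 vz vw; apply: (@val_ev_le_ind `|val (br z w)|) => //.
by move: vz vw; clear; lia.
Qed.

(** Here [F] expresses a coordinate through [x] and [y]. Without cancellation on the edge the least
    weight is the valuation -1 itself, which gives the first alternative; with cancellation the
    bound on the loss forces [t = -1], and the residue of [W] is the constant [c]. *)
Lemma leading_terms_dependent (x y : K) (F : {poly {poly k}}) (p q : nat) :
  x != 0 -> y != 0 -> br x y != 0 -> val (br x y) <= 0 ->
  val x = - p%:Z -> val y = - q%:Z -> (0 < q)%N -> (q <= p)%N ->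
  val (ev x y F) = -1 -> F != 0 ->
  (forall i j : nat, F`_i`_j != 0 -> (p * i + q * j <= 1)%N) \/
  exists (d : nat) (c : k), [/\ p = (d * q)%N, y ^+ d - iota c * x != 0
    & - p%:Z < val (y ^+ d - iota c * x)].
Proof.
move=> x0 y0 xy0 vxy vx vy q0 lepq vF F0.
have p0 : (0 < p)%N by apply: leq_trans lepq.
have [|h [s [t [a [b [h0 xE yE bez]]]]]] := @int_direction (val x) (val y).
  by rewrite vx oppr_eq0 eqz_nat -lt0n.
have s0 : s < 0 by rewrite -(pmulr_rlt0 _ h0) -xE vx oppr_lt0 ltz_nat.
have t0 : t < 0 by rewrite -(pmulr_rlt0 _ h0) -yE vy oppr_lt0 ltz_nat.
have [I [J [FIJ min]]] := exists_min_monomial s t F0.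
(* The exponent of [y] starts at its maximum [J] and falls by the absolute value of [s] per step, so
   [e] bounds the edge length. Since [s < 0], the other end has the smaller [ex], whence the shift
   by [e] in [l]. *)
pose e := (J %/ `|s|)%N.
have eJ : - s * e%:Z <= J%:Z by rewrite /e; move: s0; clear; nia.
have omJ : s * I%:Z + t * J%:Z <= - (s * t * e%:Z).
  by move: eJ s0 t0; clear; nia.
have om_le i j : F`_i`_j != 0 -> s * I%:Z + t * J%:Z <= s * i%:Z + t * j%:Z by case/min.
pose l := b * I%:Z - a * J%:Z - e%:Z.
have width i j : F`_i`_j != 0 -> s * i%:Z + t * j%:Z = s * I%:Z + t * J%:Z ->
    l <= b * i%:Z - a * j%:Z <= l + e%:Z.
  move=> Fij wij; have [_ jJ] := min _ _ Fij; have {}jJ := jJ (esym wij).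
  have [_ jE] := edge_step bez wij.
  have lt_e : (J < e.+1 * `|s|)%N by rewrite /e ltn_ceil // absz_gt0 lt_eqF.
  move: jE s0 jJ lt_e; rewrite /l.
  move: (b * I%:Z - a * _) (b * i%:Z - _) => u v; clear -e; nia.
have flat : - 1 <= h * (s * I%:Z + t * J%:Z) ->
    forall i j : nat, F`_i`_j != 0 -> (p * i + q * j <= 1)%N.
  move=> om1 i j /om_le; rewrite -(ler_pM2l h0).
  rewrite [h * (s * i%:Z + _)]mulrDr !mulrA -xE -yE vx vy.
  by move: om1; move: (h * _) => v; clear; lia.
have [[Fxy vFE]|] := blowup_step bez x0 y0 xy0 h0 xE yE FIJ om_le width.
  by left; apply: flat; rewrite -vFE vF.
move=> [c [G [e' [u [[z0 w0 vz vw] [Ge' e'e] [br0 brE] [u0 vu FE]]]]]].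
have [|G0 vG] := val_ev_le z0 w0 br0 _ vw Ge'; first by rewrite vz.
move: vF; rewrite FE valM // vu => vF.
rewrite brE vz xE yE in vG.
(* The discrepancy of [(x, y)] is nonnegative, so [e'] may be raised to [e]; then
   [val (br x y) <= 0] is used. *)
have {vG} vG : -1 <= h * (s * I%:Z + t * J%:Z) + e%:Z * (- (h * s) - h * t - 1).
  rewrite -[X in X <= _]vF lerD2l; apply: le_trans vG _.
  have hst : val x + val y + 1 <= val (br x y) := val_br xy0.
  move: hst vxy e'e; rewrite xE yE.
  move: (h * s) (h * t) (val _) => A B C hst vxy e'e.
  apply: (@le_trans _ _ (e%:Z * (C - A - B + h - h - 1))).
    by apply: ler_wpM2r; move: hst e'e; clear; lia.
  apply: ler_wpM2l => //; move: vxy; clear; lia.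
case: (posnP e) => [e0|e0].
  by left; apply: flat; move: vG; rewrite e0 mul0r addr0.
right; have t1 : t = -1.
  have ts : s <= t by rewrite -(ler_pM2l h0) -xE -yE vx vy lerN2 lez_nat.
  have [//|t1] := eqVneq t (-1).
  have [s2|s2] := eqVneq s (-2).
    have t2 : t = -2 by move: t1 t0 ts; rewrite s2; clear; lia.
    by move: bez; rewrite s2 t2; clear; lia.
  (* With weights [s, t <= -2], not both [-2], the bound reads
     [e (h (s t + s + t) + 1) <= 1] although [s t + s + t >= 1]. *)
  exfalso; move: vG h0 e0 omJ ts t1 t0 s2; clear.
  move: (s * I%:Z + t * J%:Z) => om vG h0 e0 omJ ts t1 t0 s2.
  have : h * (s * t + s + t) >= h by nia.
  have : h * om <= - (h * (s * t)) * e%:Z by nia.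
  nia.
(* For [t = -1] the chart variable is [W = y ^+ d / x] with [d = -s], so [x * (W - c)] is the
   required combination. *)
exists `|s|%N, c; move: w0 vw; rewrite t1.
set W := x ^ _ * _ => w0 vw.
have yxE : y ^+ `|s| - iota c * x = x * (W - iota c).
  rewrite mulrBr [x * iota c]mulrC /W exprN1 mulrA divff // mul1r.
  by rewrite (exprnP y) -ltz0_abs.
rewrite yxE; split; last by rewrite valM // vx ltrDl.
  by apply/eqP; rewrite -eqz_nat PoszM -[p%:Z]opprK -[q%:Z]opprK -vx -vy xE yE t1 ltz0_abs //;
     apply/eqP; ring.
exact: mulf_neq0.
Qed.

End Bivariate.

(** * Rational functions in two variables *)

Lemma quotient_ruleD (L : fieldType) (a b c d a' b' c' d' : L) : b != 0 -> d != 0 ->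
  ((a' * d + a * d' + (c' * b + c * b')) * (b * d)
    - (a * d + c * b) * (b' * d + b * d')) / (b * d) ^+ 2 =
  (a' * b - a * b') / b ^+ 2 + (c' * d - c * d') / d ^+ 2.
Proof. by move=> b0 d0; field; rewrite b0 d0. Qed.

Lemma quotient_ruleM (L : fieldType) (a b c d a' b' c' d' : L) : b != 0 -> d != 0 ->
  ((a' * c + a * c') * (b * d) - (a * c) * (b' * d + b * d')) / (b * d) ^+ 2 =
  (a' * b - a * b') / b ^+ 2 * (c / d) + a / b * ((c' * d - c * d') / d ^+ 2).
Proof. by move=> b0 d0; field; rewrite b0 d0. Qed.

(** * Extension of a derivation to the field of fractions *)

Section FractionDerivation.
Variables (R : idomainType) (D : R -> R).
Hypothesis derD : forall x y, D (x + y) = D x + D y.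
Hypothesis derM : forall x y, D (x * y) = D x * y + x * D y.
Local Notation "x %:F" := (@tofrac R x).

Definition numer (x : {fraction R}) : R := \n_(repr x).
Definition denom (x : {fraction R}) : R := \d_(repr x).

Lemma denom_neq0 x : denom x != 0.
Proof. exact: denom_ratioP. Qed.

Lemma numer_denomE x : x = (numer x)%:F / (denom x)%:F.
Proof.
have dF0 : (denom x)%:F != 0 by rewrite tofrac_eq0 denom_neq0.
apply: (mulIf dF0); rewrite mulfVK //.
rewrite -{1}[x]reprK /numer /denom; move: (repr x) (denom_ratioP (repr x)) => r d0.
rewrite !piE; apply/eqmodP; rewrite /= FracField.equivfE /FracField.mulf.
by rewrite !numden_Ratio ?mulr1 ?oner_eq0 // mulrC.
Qed.

Lemma eq_frac (a b c d : R) : b != 0 -> d != 0 ->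
  (a%:F / b%:F == c%:F / d%:F) = (a * d == c * b).
Proof.
by move=> b0 d0; rewrite eqr_div ?tofrac_eq0 // -!tofracM tofrac_eq.
Qed.

Definition frac_der (x : {fraction R}) : {fraction R} :=
  (D (numer x) * denom x - numer x * D (denom x))%:F / (denom x ^+ 2)%:F.

(** Independence of the chosen representative [n / d]: the relation [a * d = n * b] is
    differentiated. *)
Lemma frac_derE (a b : R) : b != 0 ->
  frac_der (a%:F / b%:F) = (D a * b - a * D b)%:F / (b ^+ 2)%:F.
Proof.
move=> b0; rewrite /frac_der; set x := a%:F / b%:F.
have d0 := denom_neq0 x; move: (numer_denomE x); rewrite {1}/x.
move: (numer x) (denom x) d0 => n d d0 /eqP; rewrite eq_frac // => /eqP E.
have DE : D a * d + a * D d = D n * b + n * D b by rewrite -!derM E.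
apply/eqP; rewrite eq_sym eq_frac ?expf_neq0 //; apply/eqP.
transitivity (d * b * (D a * d + a * D d) - a * d * (d * D b) - d * D d * (a * b)).
  by ring.
rewrite DE E.
transitivity (d * b * (D n * b + n * D b) - n * b * (d * D b)
  - b * D d * (n * b)); last by ring.
congr (_ - _); rewrite -[in RHS]E; ring.
Qed.

Lemma frac_derF (a : R) : frac_der a%:F = (D a)%:F.
Proof.
have D1 : D 1 = 0.
  by apply: (addrI (D 1)); rewrite addr0 -{3}[1]mulr1 derM mulr1 mul1r.
by rewrite -[X in frac_der X]divr1 -tofrac1 frac_derE ?oner_neq0 // D1
  expr1n mulr1 mulr0 subr0 tofrac1 divr1.
Qed.

Lemma frac_derD x y : frac_der (x + y) = frac_der x + frac_der y.
Proof.
rewrite [x]numer_denomE [y]numer_denomE.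
move: (numer x) (denom x) (denom_neq0 x) (numer y) (denom y) (denom_neq0 y).
move=> a b b0 c d d0; have [bF dF] : b%:F != 0 /\ d%:F != 0 by rewrite !tofrac_eq0.
have -> : a%:F / b%:F + c%:F / d%:F = (a * d + c * b)%:F / (b * d)%:F.
  by rewrite addf_div // tofracD !tofracM.
rewrite !frac_derE ?mulf_neq0 // derD !derM.
rewrite !(tofracD, tofracN, tofracM, tofracXn).
exact: quotient_ruleD.
Qed.

Lemma frac_derM x y : frac_der (x * y) = frac_der x * y + x * frac_der y.
Proof.
rewrite [x]numer_denomE [y]numer_denomE.
move: (numer x) (denom x) (denom_neq0 x) (numer y) (denom y) (denom_neq0 y).
move=> a b b0 c d d0; have [bF dF] : b%:F != 0 /\ d%:F != 0 by rewrite !tofrac_eq0.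
have -> : a%:F / b%:F * (c%:F / d%:F) = (a * c)%:F / (b * d)%:F.
  by rewrite mulf_div !tofracM.
rewrite !frac_derE ?mulf_neq0 // !derM.
rewrite !(tofracD, tofracN, tofracM, tofracXn).
exact: quotient_ruleM.
Qed.

End FractionDerivation.

Lemma bracket_Leibniz (L : comNzRingType) (x y x1 y1 u1 x2 y2 u2 : L) :
  (x1 * y + x * y1) * u2 - (x2 * y + x * y2) * u1 =
  x * (y1 * u2 - y2 * u1) + y * (x1 * u2 - x2 * u1).
Proof. by ring. Qed.

(** * The degree valuation and the Jacobian bracket on the rational function field *)

Section SurfaceField.
Variable k : fieldType.
Local Notation R2 := {poly {poly k}}.
Local Notation K := {fraction R2}.
Local Notation "x %:F" := (@tofrac _ x).

(** The outer variable is called tau and the inner one lambda below. *)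
Definition coef_der (p : R2) : R2 := map_poly (@deriv k) p.

Lemma coef_coef_der p i : (coef_der p)`_i = (p`_i)^`().
Proof. by rewrite coef_map_id0 // deriv0. Qed.

Lemma coef_derD p q : coef_der (p + q) = coef_der p + coef_der q.
Proof. by apply/polyP => i; rewrite !(coefD, coef_coef_der) derivD. Qed.

Lemma coef_derM p q : coef_der (p * q) = coef_der p * q + p * coef_der q.
Proof.
apply/polyP => i; rewrite coef_coef_der coefD !coefM raddf_sum -big_split.
by apply: eq_bigr => j _ /=; rewrite !coef_coef_der derivM.
Qed.

Lemma size_coef_der p : (size (coef_der p) <= size p)%N.
Proof. by apply/leq_sizeP => i hi; rewrite coef_coef_der nth_default // deriv0. Qed.

Definition scalar (c : k) : K := (c%:P%:P)%:F.

HB.instance Definition _ := GRing.RMorphism.copy scalar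
  (@tofrac R2 \o (@polyC {poly k} \o @polyC k)).

(** Minus the degree in the outer variable, with junk value at [0]. *)
Definition fval (x : K) : int := (size (denom x))%:Z - (size (numer x))%:Z.

Lemma fvalE (a b : R2) : a != 0 -> b != 0 ->
  fval (a%:F / b%:F) = (size b)%:Z - (size a)%:Z.
Proof.
move=> a0 b0; rewrite /fval; set x := a%:F / b%:F.
have d0 := denom_neq0 x; have /eqP := numer_denomE x; rewrite {1}/x eq_frac // => /eqP.
have n0 : numer x != 0.
  have : x != 0 by rewrite /x mulf_neq0 ?invr_eq0 ?tofrac_eq0.
  by apply: contraNneq => nE; rewrite [x]numer_denomE nE tofrac0 mul0r.
move: (numer x) (denom x) d0 n0 => n d d0 n0 /(congr1 (fun p : R2 => size p)).
rewrite !size_mul //; move: a0 b0 d0 n0; rewrite -!size_poly_gt0.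
by move: (size a) (size b) (size n) (size d); clear; lia.
Qed.

Lemma fvalF (a : R2) : a != 0 -> fval a%:F = 1 - (size a)%:Z.
Proof.
move=> a0; rewrite -[a%:F]divr1 -tofrac1 fvalE ?oner_neq0 //.
by rewrite size_poly1.
Qed.

Lemma frac_neq0 (x : K) : x != 0 -> exists a b : R2, [/\ a != 0, b != 0 & x = a%:F / b%:F].
Proof.
move=> x0; exists (numer x), (denom x); split; [|exact: denom_neq0|exact: numer_denomE].
by apply: contraNneq x0 => nE; rewrite [x]numer_denomE nE tofrac0 mul0r.
Qed.

Lemma fvalM (x y : K) : x != 0 -> y != 0 -> fval (x * y) = fval x + fval y.
Proof.
move=> /frac_neq0[a [b [a0 b0 ->]]] /frac_neq0[c [d [c0 d0 ->]]].
rewrite mulf_div -!tofracM !fvalE ?mulf_neq0 // !size_mul //.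
move: a0 b0 c0 d0; rewrite -!size_poly_gt0.
by move: (size a) (size b) (size c) (size d); clear; lia.
Qed.

Lemma fvalD (x y : K) : x != 0 -> y != 0 -> x + y != 0 ->
  Num.min (fval x) (fval y) <= fval (x + y).
Proof.
move=> /frac_neq0[a [b [a0 b0 ->]]] /frac_neq0[c [d [c0 d0 ->]]].
rewrite addf_div ?tofrac_eq0 // -!tofracM -tofracD => xy0.
have n0 : a * d + c * b != 0.
  by apply: contraNneq xy0 => ->; rewrite tofrac0 mul0r.
rewrite !fvalE ?mulf_neq0 // size_mul //.
have := size_polyD (a * d) (c * b); rewrite !size_mul // leq_max ge_min.
move: a0 b0 c0 d0; rewrite -!size_poly_gt0 => a0 b0 c0 d0.
by case/orP => h; apply/orP; [left|right]; move: a0 b0 c0 d0 h;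
  move: (size (a * d + c * b : R2)) (size a) (size b) (size c) (size d); clear; lia.
Qed.

Lemma fval_scalar c : c != 0 -> fval (scalar c) = 0.
Proof.
by move=> c0; rewrite fvalF ?polyC_eq0 // size_polyC polyC_eq0 c0.
Qed.

Lemma fvalB_ge (P Q : K) m : P == 0 \/ m <= fval P -> Q == 0 \/ m <= fval Q ->
  P - Q != 0 -> m <= fval (P - Q).
Proof.
have fvalN (u : K) : u != 0 -> fval (- u) = fval u.
  move=> u0; rewrite -mulN1r fvalM ?oppr_eq0 ?oner_neq0 //.
  by rewrite -(rmorphN1 scalar) fval_scalar ?oppr_eq0 ?oner_neq0 // add0r.
have [->|P0] := eqVneq P 0; have [->|Q0] := eqVneq Q 0.
- by rewrite subr0 eqxx.
- by move=> _ [//|hQ]; rewrite sub0r fvalN.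
- by move=> [//|hP] _; rewrite subr0.
have NQ0 : - Q != 0 by rewrite oppr_eq0.
move=> [//|hP] [//|hQ] PQ0.
by apply: le_trans (fvalD P0 NQ0 PQ0); rewrite fvalN // le_min hP.
Qed.

Definition tau_der : K -> K := frac_der (fun p : R2 => p^`()).
Definition lam_der : K -> K := frac_der coef_der.
Definition bracket (x y : K) : K := tau_der x * lam_der y - lam_der x * tau_der y.

Let tauD : forall x y : R2, (x + y)^`() = x^`() + y^`() := @derivD _.
Let tauM : forall x y : R2, (x * y)^`() = x^`() * y + x * y^`() := @derivM _.

Lemma bracketDl (x y u : K) : bracket (x + y) u = bracket x u + bracket y u.
Proof.
rewrite /bracket /tau_der /lam_der !(frac_derD tauD tauM) !(frac_derD coef_derD coef_derM).
by rewrite !mulrDl opprD addrACA.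
Qed.

Lemma bracketMl (x y u : K) : bracket (x * y) u = x * bracket y u + y * bracket x u.
Proof.
rewrite /bracket /tau_der /lam_der !(frac_derM tauM) !(frac_derM coef_derM).
exact: bracket_Leibniz.
Qed.

Lemma bracketC (x y : K) : bracket x y = - bracket y x.
Proof. by rewrite /bracket opprB mulrC [tau_der y * _]mulrC. Qed.

Lemma bracketxx (x : K) : bracket x x = 0.
Proof. by rewrite /bracket mulrC subrr. Qed.

Lemma bracket_scalar c (u : K) : bracket (scalar c) u = 0.
Proof.
rewrite /bracket /tau_der /lam_der !(frac_derF tauM) !(frac_derF coef_derM) derivC.
have -> : coef_der c%:P%:P = 0.
  by apply/polyP => i; rewrite coef_coef_der coefC coef0; case: eqP; rewrite ?derivC ?deriv0.
by rewrite tofrac0 !mul0r subr0.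
Qed.

(** If [D] lowers the degree of polynomials by at least [m], so does the quotient rule on
    fractions. *)
Lemma fval_frac_der (D : R2 -> R2) (m : nat) (x : K) :
  (forall p q : R2, D (p * q) = D p * q + p * D q) ->
  (forall p : R2, p != 0 -> (size (D p) + m <= size p)%N) ->
  x != 0 -> frac_der D x != 0 -> fval x + m%:Z <= fval (frac_der D x).
Proof.
move=> DM Dsize /frac_neq0[a [b [a0 b0 ->]]]; rewrite frac_derE // => dx0.
have n0 : D a * b - a * D b != 0.
  by apply: contraNneq dx0 => ->; rewrite tofrac0 mul0r.
rewrite !fvalE ?expf_neq0 // expr2 size_mul //.
have hN : (size (- (a * D b)) <= (size a + size (D b)).-1)%N.
  by rewrite size_polyN; apply: size_polyMleq.
have hP : (size (D a * b)%R <= (size (D a) + size b).-1)%N by apply: size_polyMleq.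
have := size_polyD (D a * b) (- (a * D b)).
have := Dsize _ a0; have := Dsize _ b0; move: n0 a0 b0 hN hP.
rewrite -!size_poly_gt0.
move: (size (D a * b - a * D b : R2)) (size (D a * b : R2)) (size (- (a * D b) : R2))
  (size (D a)) (size (D b)) (size a) (size b).
by clear; lia.
Qed.

(** The derivative in tau lowers the degree in tau and the derivative in lambda does not raise it,
    so both products in the Jacobian gain one. *)
Lemma fval_bracket (x y : K) : bracket x y != 0 -> fval x + fval y + 1 <= fval (bracket x y).
Proof.
move=> xy0.
have b0 u : bracket 0 u = 0 by rewrite -(rmorph0 scalar) bracket_scalar.
have x0 : x != 0 by apply: contraNneq xy0 => ->; rewrite b0.
have y0 : y != 0 by apply: contraNneq xy0 => ->; rewrite bracketC b0 oppr0.
have tau_ge (z : K) : z != 0 -> tau_der z != 0 -> fval z + 1 <= fval (tau_der z).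
  move=> z0; apply: (fval_frac_der tauM) => // p p0; rewrite addn1.
  exact: lt_size_deriv.
have lam_ge (z : K) : z != 0 -> lam_der z != 0 -> fval z <= fval (lam_der z).
  move=> z0 dz0; have := @fval_frac_der coef_der 0 z coef_derM _ z0 dz0.
  by rewrite addr0; apply=> p _; rewrite addn0 size_coef_der.
have term (u v : K) : u != 0 -> v != 0 ->
    tau_der u * lam_der v == 0 \/ fval u + fval v + 1 <= fval (tau_der u * lam_der v).
  move=> u0 v0; have [->|du] := eqVneq (tau_der u) 0; first by left; rewrite mul0r.
  have [->|dv] := eqVneq (lam_der v) 0; first by left; rewrite mulr0.
  right; rewrite (fvalM du dv) [_ + 1]addrAC.
  by have := lerD (tau_ge _ u0 du) (lam_ge _ v0 dv).
have := term _ _ x0 y0; have := term _ _ y0 x0; rewrite [fval y + _]addrC.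
move: xy0; rewrite /bracket [lam_der x * _]mulrC => xy0 hQ hP.
exact: fvalB_ge hP hQ xy0.
Qed.

End SurfaceField.

(** [k] is algebraically closed in its rational function field. After removal of the gcd, the
    denominator divides a power of the coprime numerator, hence is constant; the numerator is then a
    polynomial annihilated by a nonzero polynomial over [k], hence constant too. *)
Lemma homogeneous_root (k : fieldType) (p a b : {poly k}) :
  p != 0 -> b != 0 ->
  \sum_(i < size p) p`_i *: (a ^+ i * b ^+ ((size p).-1 - i)) = 0 ->
  exists c, a = c *: b.
Proof.
move=> p0 b0 sum0; pose n := (size p).-1.
have sp : size p = n.+1 by rewrite /n prednK // size_poly_gt0.
have g0 : gcdp a b != 0 by rewrite gcdp_eq0 negb_and b0 orbT.
have [a1 aE] := dvdpP _ _ (dvdp_gcdl a b).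
have [b1 bE] := dvdpP _ _ (dvdp_gcdr a b).
have cop : coprimep b1 a1.
  rewrite coprimep_sym; have ab0 : (a != 0) || (b != 0) by rewrite b0 orbT.
  have := coprimep_div_gcd ab0.
  by rewrite [X in X %/ _]aE [X in coprimep _ (X %/ _)]bE !mulpK.
move: (gcdp a b) g0 aE bE => g g0 aE bE.
have {sum0} sum1 : \sum_(i < n.+1) p`_i *: (a1 ^+ i * b1 ^+ (n - i)) = 0.
  apply: (mulfI (expf_neq0 n g0)); rewrite mulr0 -{}[RHS]sum0 mulr_sumr sp.
  apply: eq_bigr => i _; rewrite -scalerAr; congr (_ *: _).
  rewrite [in RHS]aE [in RHS]bE !exprMn.
  have -> : g ^+ n = g ^+ i * g ^+ (n - i) by rewrite -exprD subnKC // -ltnS.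
  by rewrite -/n; ring.
have b1dvd : b1 %| a1 ^+ n.
  move: sum1; rewrite big_ord_recr /= subnn mulr1 => /eqP; rewrite addrC addr_eq0 => /eqP E.
  have pn : p`_n != 0 by rewrite -lead_coefE lead_coef_eq0.
  rewrite -(dvdpZr _ _ pn) E dvdpNr; apply: (big_ind (fun r => b1 %| r)) => [|r s|i _].
  - exact: dvdp0.
  - exact: dvdp_add.
  - rewrite -mul_polyC !dvdp_mull // -(prednK (_ : 0 < n - i)%N) ?subn_gt0 //.
    by rewrite exprS dvdp_mulr.
have /size_poly1P[c c0 b1c] : size b1 == 1.
  by rewrite -coprimepp; apply: coprimep_dvdl b1dvd _; apply: coprimep_expr.
have comp0 : (\sum_(i < n.+1) (p`_i * c ^+ (n - i)) *: 'X^i) \Po a1 = 0.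
  rewrite raddf_sum /= -[RHS]sum1; apply: eq_bigr => i _.
  by rewrite comp_polyZ comp_Xn_poly b1c -polyC_exp [a1 ^+ i * _]mulrC mul_polyC scalerA.
pose P := \sum_(i < n.+1) (p`_i * c ^+ (n - i)) *: 'X^i.
have Pn : P`_n = p`_n.
  rewrite /P -(poly_def _ (fun i => p`_i * c ^+ (n - i))) coef_poly ltnSn.
  by rewrite subnn expr0 mulr1.
have a1c : (size a1 <= 1)%N.
  rewrite leqNgt; apply/negP => a1s; have P0 : P != 0.
    apply: contraNneq p0 => P0; move: Pn; rewrite P0 coef0 /n -lead_coefE => /esym/eqP.
    by rewrite lead_coef_eq0.
  by have := comp_poly_eq0 P a1s; rewrite comp0 eqxx (negPf P0).
exists (a1`_0 / c); rewrite {1}aE [in RHS]bE b1c (size1_polyC a1c) !mul_polyC.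
by rewrite scalerA coefC eqxx mulfVK.
Qed.

Lemma expr_div_common (L : fieldType) (u v : L) (i n : nat) : v != 0 -> (i <= n)%N ->
  (u / v) ^+ i = u ^+ i * v ^+ (n - i) / v ^+ n.
Proof.
move=> v0 lei; rewrite -[in v ^+ n](subnKC lei) exprD expr_div_n.
by field; rewrite !expf_neq0.
Qed.

Section Residue.
Variable k : fieldType.
Local Notation R2 := {poly {poly k}}.
Local Notation K := {fraction R2}.
Local Notation "x %:F" := (@tofrac _ x).

(** The residue of [a / b] is the quotient of the leading coefficients, a rational function of
    lambda; it is a root of [p], hence constant by [homogeneous_root]. *)
Lemma fval_residue (p : {poly k}) (W : K) : p != 0 -> W != 0 -> fval W = 0 ->
  ge_val (@fval k) 1 (ev1 (@scalar k) W p) -> exists c, ge_val (@fval k) 1 (W - scalar c).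
Proof.
move=> p0 /frac_neq0[a [b [a0 b0 ->]]]; rewrite fvalE // => sab.
have {sab} sab : size a = size b by move: sab; move: (size a) (size b); clear; lia.
pose n := (size p).-1.
have sp : size p = n.+1 by rewrite /n prednK // size_poly_gt0.
pose N : R2 := \sum_(i < n.+1) (p`_i)%:P%:P * (a ^+ i * b ^+ (n - i)).
have bF : b%:F != 0 by rewrite tofrac_eq0.
have evN : ev1 (@scalar k) (a%:F / b%:F) p = N%:F / (b ^+ n)%:F.
  rewrite -{1}(coefK p) poly_def rmorph_sum /= sp rmorph_sum /= mulr_suml.
  apply: eq_bigr => i _; rewrite ev1Z rmorphXn /= ev1X.
  rewrite !tofracM !tofracXn -mulrA; congr (_ * _).
  have lt_i : (i <= n)%N by rewrite -ltnS.
  exact: expr_div_common.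
pose s := (size b).-1.
have sb : size b = s.+1 by rewrite /s prednK // size_poly_gt0.
have top i : (i <= n)%N ->
    (a ^+ i * b ^+ (n - i))`_(n * s) = lead_coef a ^+ i * lead_coef b ^+ (n - i).
  move=> lei; rewrite -!lead_coef_exp -lead_coefM lead_coefE; congr (_`_ _).
  rewrite size_mul ?expf_neq0 // -[size (a ^+ i)]prednK ?size_poly_gt0 ?expf_neq0 //.
  rewrite -[size (b ^+ _)]prednK ?size_poly_gt0 ?expf_neq0 // !size_exp sab sb /=.
  by rewrite addnS /= -mulnDr subnKC // mulnC.
(* [n * s] is the degree of the denominator [b ^+ n], so positive valuation kills this coefficient
   of [N]. *)
move=> hN; have N0 : N`_(n * s) = 0.
  have [->|Nn0] := eqVneq N 0; first by rewrite coef0.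
  move: hN; rewrite /ge_val evN mulf_eq0 invr_eq0 !tofrac_eq0 (negPf Nn0) expf_eq0 (negPf b0).
  rewrite andbF /= fvalE ?expf_neq0 // => hN; apply: nth_default.
  have : (size (b ^+ n) = (n * s).+1)%N.
    by rewrite -[size _]prednK ?size_poly_gt0 ?expf_neq0 // size_exp sb mulnC.
  by move: hN; move: (size N) (size (b ^+ n)) (n * s)%N; clear; lia.
have [||c cE] := @homogeneous_root k p (lead_coef a) (lead_coef b) p0.
- by rewrite lead_coef_eq0.
- rewrite sp /= -[RHS]N0 coef_sum; apply: eq_bigr => i _.
  have lei : (i <= n)%N by rewrite -ltnS.
  by rewrite coefCM (top _ lei) mul_polyC.
exists c; have -> : a%:F / b%:F - scalar c = (a - c%:P%:P * b)%:F / b%:F.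
  by rewrite tofracB tofracM mulrBl mulfK.
have [->|d0] := eqVneq (a - c%:P%:P * b) 0; first by rewrite tofrac0 mul0r /ge_val eqxx.
rewrite /ge_val; apply/orP; right; rewrite fvalE //.
have : (size (a - c%:P%:P * b)%R <= s)%N.
  apply/leq_sizeP => j; rewrite leq_eqVlt => /orP[/eqP <-|ltj].
    rewrite coefB coefCM /s; rewrite lead_coefE sab in cE.
    by rewrite cE lead_coefE mul_polyC subrr.
  by rewrite coefB coefCM !nth_default ?sab ?sb // mulr0 subrr.
by move: sb; move: (size b) (size (a - c%:P%:P * b)); clear; lia.
Qed.

Lemma leading_forms_dependent (X Y : R2) (F : {poly {poly k}}) (p q : nat) :
  size X = p.+1 -> size Y = q.+1 -> (0 < q)%N -> (q <= p)%N ->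
  bracket X%:F Y%:F != 0 -> fval (bracket X%:F Y%:F) <= 0 ->
  (exists2 U : R2, ev (@scalar k) X%:F Y%:F F = U%:F & size U = 2) ->
  (forall i j : nat, F`_i`_j != 0 -> (p * i + q * j <= 1)%N) \/
  exists (d : nat) (c : k), p = (d * q)%N /\ (size (Y ^+ d - c%:P%:P * X)%R <= p)%N.
Proof.
move=> sX sY q0 qp br0 brv [U FU sU].
have X0 : X != 0 by rewrite -size_poly_gt0 sX.
have Y0 : Y != 0 by rewrite -size_poly_gt0 sY.
have U0 : U != 0 by rewrite -size_poly_gt0 sU.
have F0 : F != 0.
  apply: contraNneq U0 => F0; move: FU; rewrite F0 rmorph0 => /esym/eqP.
  by rewrite tofrac_eq0.
have [||||||||flat|] := @leading_terms_dependent _ _ (@scalar k) (@fval k) (@bracket k)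
  (@fvalM k) (@fvalD k) (@fval_scalar k) fval_residue (@bracketDl k) (@bracketMl k)
  (@bracketC k) (@bracketxx k) (@bracket_scalar k) (@fval_bracket k) X%:F Y%:F F p q _ _ br0 brv.
- by rewrite tofrac_eq0.
- by rewrite tofrac_eq0.
- by rewrite fvalF // sX; clear; lia.
- by rewrite fvalF // sY; clear; lia.
- exact: q0.
- exact: qp.
- by rewrite FU fvalF // sU.
- exact: F0.
- by left.
move=> [d [c [pE E0 vE]]]; right; exists d, c; split=> //.
have EF : Y%:F ^+ d - scalar c * X%:F = (Y ^+ d - c%:P%:P * X)%:F.
  by rewrite tofracB tofracM tofracXn.
move: vE E0; rewrite EF tofrac_eq0 => vE E0; move: vE; rewrite fvalF //.
by move: (size (Y ^+ d - _)); clear; lia.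
Qed.

End Residue.

(** * The theorem of Jung and van der Kulk *)

Section PlaneAutomorphisms.
Variable k : fieldType.
Local Notation P2 := {mpoly k[2]}.
Local Notation R2 := {poly {poly k}}.

Lemma ord2P (i : 'I_2) : i = 0 \/ i = 1.
Proof. by case: i => [[|[|//]] hi]; [left|right]; apply: val_inj. Qed.

Lemma mpoly2_ind (S : P2 -> Prop) :
  (forall c, S c%:MP) -> S 'X_0 -> S 'X_1 ->
  (forall p q, S p -> S q -> S (p + q)) -> (forall p q, S p -> S q -> S (p * q)) ->
  forall p, S p.
Proof.
move=> SC S0 S1 SD SM p.
have SX i : S 'X_i by case: (ord2P i) => ->.
rewrite [p]mpolyE; apply: (big_ind S) => [|//|m _]; first by rewrite -mpolyC0.
rewrite -mul_mpolyC; apply: (SM) => //; rewrite mpolyXE_id.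
apply: (big_ind S) => [|//|i _]; first by rewrite -mpolyC1.

by elim: (m i) => [|n IH]; [rewrite expr0 -mpolyC1|rewrite exprS; apply: (SM)].
Qed.

Section Eval.
Variables (A : comNzRingType) (f : {rmorphism k -> A}) (X Y : A).
Definition meval2 : P2 -> A := mmap f (fun i => if i == 0 then X else Y).

HB.instance Definition _ := GRing.RMorphism.copy meval2 (mmap f (fun i => if i == 0 then X else Y)).

Lemma meval2_0 : meval2 'X_0 = X.
Proof. by rewrite /meval2 mmapX mmap1U. Qed.

Lemma meval2_1 : meval2 'X_1 = Y.
Proof. by rewrite /meval2 mmapX mmap1U. Qed.

Lemma meval2C c : meval2 c%:MP = f c.
Proof. by rewrite /meval2 mmapC. Qed.

Lemma meval2Z c p : meval2 (c *: p) = f c * meval2 p.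
Proof. by rewrite /meval2 mmapZ. Qed.

End Eval.

Lemma meval2_ext (A : comNzRingType) (g h : {rmorphism P2 -> A}) :
  (forall c, g c%:MP = h c%:MP) -> g 'X_0 = h 'X_0 -> g 'X_1 = h 'X_1 -> g =1 h.
Proof.
move=> hC h0 h1 p; elim/mpoly2_ind: p => // p q hp hq.
  by rewrite !rmorphD hp hq.
by rewrite !rmorphM hp hq.
Qed.

(** The substitution [x = tau], [y = tau lambda] turns the total degree into the degree
    in tau and leading forms into leading coefficients. *)
Definition polar : P2 -> R2 :=
  meval2 (@polyC {poly k} \o @polyC k) 'X ('X * 'X%:P).

HB.instance Definition _ := GRing.RMorphism.copy polar
  (meval2 (@polyC {poly k} \o @polyC k) 'X ('X * 'X%:P)).

Lemma polarE p : polar p =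
  \sum_(m <- msupp p) ((p@_m *: 'X^(m 1))%:P * 'X^(mdeg m)).
Proof.
rewrite /polar /meval2 /mmap; apply: eq_bigr => m _.
rewrite /mmap1 big_ord_recl big_ord1 /= (_ : lift ord0 ord0 = 1); last exact: val_inj.
rewrite mdegE big_ord_recl big_ord1 /= (_ : lift ord0 ord0 = 1); last exact: val_inj.
rewrite exprMn -mul_polyC polyCM -mulrA; congr (_ * _).
by rewrite -!polyC_exp mulrA -exprD mulrC.
Qed.

(** Total degree and exponent of the second variable determine a monomial, so the substitution
    merges no terms. *)
Lemma polar_coef p (m : 'X_{1..2}) : (polar p)`_(mdeg m)`_(m 1) = p@_m.
Proof.
rewrite polarE !coef_sum.
rewrite (eq_bigr (fun m' => p@_m' * (m' == m)%:R)) => [|m' _]; last first.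
  rewrite coefCM coefXn; case: eqP => [dE|dE] /=.
    rewrite mulr1 coefZ coefXn; case: eqP => [jE|jE]; congr (_ * _%:R).
      rewrite (_ : m' == m) //; apply/eqP/mnmP => i.
      move: dE; rewrite !mdegE !big_ord_recl !big_ord0 /= !addn0.
      rewrite (_ : lift ord0 ord0 = 1 :> 'I_2); last exact: val_inj.
      rewrite jE => /addIn dE; case: (ord2P i) => -> //.
    by case: eqP jE => // ->.
  by rewrite mulr0 coef0; case: eqP dE => [->//|_ _]; rewrite mulr0.
have [mp|mp] := boolP (m \in msupp p).
  rewrite (bigD1_seq m) //= eqxx mulr1 big1 ?addr0 // => m' /negPf ->.
  by rewrite mulr0.
rewrite big1_seq ?memN_msupp_eq0 // => m' /andP[_ m'p].
by case: eqP => [E|_]; rewrite ?mulr0 //; rewrite -E m'p in mp.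
Qed.

Lemma size_polar p : size (polar p) = msize p.
Proof.
have [->|p0] := eqVneq p 0; first by rewrite rmorph0 size_poly0 mmeasure0.
apply/eqP; rewrite eqn_leq; apply/andP; split.
  rewrite polarE; apply: (leq_trans (size_sum _ _ _)); apply/bigmax_leqP_seq => m mp _.
  apply: leq_trans (size_polyMleq _ _) _; rewrite size_polyXn addnS /=.
  apply: (@leq_trans (1 + mdeg m)); last by rewrite add1n msize_mdeg_lt.
  by rewrite leq_add2r size_polyC leq_b1.
rewrite -mlead_deg // ltnNge; apply/negP => /(nth_default 0) c0.
have := polar_coef p (mlead p); rewrite c0 coef0 => /esym/eqP.
by rewrite mleadc_eq0 (negPf p0).
Qed.

(** * Automorphisms as pairs of polynomials *)

Definition subst2 (X Y : P2) : P2 -> P2 := meval2 (@mpolyC 2 k) X Y.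
HB.instance Definition _ X Y := GRing.RMorphism.copy (subst2 X Y) (meval2 (@mpolyC 2 k) X Y).

Lemma subst2_0 X Y : subst2 X Y 'X_0 = X. Proof. exact: meval2_0. Qed.
Lemma subst2_1 X Y : subst2 X Y 'X_1 = Y. Proof. exact: meval2_1. Qed.
Lemma subst2C X Y c : subst2 X Y c%:MP = c%:MP. Proof. exact: meval2C. Qed.
Lemma subst2Z X Y c p : subst2 X Y (c *: p) = c *: subst2 X Y p.
Proof. by rewrite [LHS]meval2Z mul_mpolyC. Qed.

Lemma subst2_ext (g h : {rmorphism P2 -> P2}) :
  (forall c, g c%:MP = c%:MP) -> (forall c, h c%:MP = c%:MP) ->
  g 'X_0 = h 'X_0 -> g 'X_1 = h 'X_1 -> g =1 h.
Proof. by move=> gC hC; apply: meval2_ext => c; rewrite gC hC. Qed.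

Lemma alg_automorphism_subst2 (phi : P2 -> P2) (X Y : P2) :
  is_alg_automorphism phi -> phi 'X_0 = X -> phi 'X_1 = Y -> phi =1 subst2 X Y.
Proof.
move=> [lin [phi1 phiM] _] X0 Y1 p.
have phiD u v : phi (u + v) = phi u + phi v.
  by have := lin 1 u v; rewrite !scale1r.
have phi0 : phi 0 = 0 by apply: (addrI (phi 0)); rewrite -phiD !addr0.
have phiC c : phi c%:MP = c%:MP.
  by rewrite -[c%:MP]mulr1 mul_mpolyC -[c *: 1]addr0 lin phi1 phi0.
elim/mpoly2_ind: p {lin} => [c|||p q hp hq|p q hp hq].
- by rewrite phiC subst2C.
- by rewrite subst2_0.
- by rewrite subst2_1.
- by rewrite (phiD p q) hp hq rmorphD.
- by rewrite (phiM p q) hp hq rmorphM.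
Qed.

Definition aut_pair (X Y : P2) : Prop := bijective (subst2 X Y).

Lemma aut_pair_automorphism X Y : aut_pair X Y -> is_alg_automorphism (subst2 X Y).
Proof.
move=> bij; split=> //.
  by move=> c u v; rewrite rmorphD /= subst2Z.
by split; [exact: rmorph1|exact: rmorphM].
Qed.

Lemma automorphism_aut_pair (phi : P2 -> P2) :
  is_alg_automorphism phi -> aut_pair (phi 'X_0) (phi 'X_1).
Proof.
move=> aut; have [_ _ bij] := aut.
exact: eq_bij bij _ (alg_automorphism_subst2 aut erefl erefl).
Qed.

Lemma aut_pair_comp (X Y U V : P2) : aut_pair X Y -> aut_pair U V ->
  aut_pair (subst2 X Y U) (subst2 X Y V).
Proof.
move=> bXY bUV; apply: (eq_bij (bij_comp bXY bUV)).
apply: (@subst2_ext (subst2 X Y \o subst2 U V)) => [c|c||] /=.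
- by rewrite !subst2C.
- by rewrite subst2C.
- by rewrite !subst2_0.
- by rewrite !subst2_1.
Qed.

Lemma inverse_aut_pair (U V U' V' : P2) :
  subst2 U V U' = 'X_0 -> subst2 U V V' = 'X_1 ->
  subst2 U' V' U = 'X_0 -> subst2 U' V' V = 'X_1 -> aut_pair U V.
Proof.
have inv A B A' B' : subst2 A B A' = 'X_0 -> subst2 A B B' = 'X_1 ->
    cancel (subst2 A' B') (subst2 A B).
  move=> E0 E1; apply: (@subst2_ext (subst2 A B \o subst2 A' B') idfun) => [c|c||] /=.
  - by rewrite !subst2C.
  - by [].
  - by rewrite subst2_0.
  - by rewrite subst2_1.
by move=> E0 E1 E0' E1'; exists (subst2 U' V'); apply: inv.
Qed.

Local Notation "p %:F" := (@tofrac _ p).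

Definition polar_frac (p : P2) : {fraction R2} := (polar p)%:F.
HB.instance Definition _ := GRing.RMorphism.copy polar_frac (@tofrac R2 \o polar).

Lemma polar0 : polar 'X_0 = 'X. Proof. exact: meval2_0. Qed.
Lemma polar1 : polar 'X_1 = 'X * 'X%:P. Proof. exact: meval2_1. Qed.
Lemma polarC c : polar c%:MP = c%:P%:P. Proof. exact: meval2C. Qed.
Lemma polarZ c p : polar (c *: p) = c%:P%:P * polar p. Proof. exact: meval2Z. Qed.

Lemma bracketF (p q : R2) :
  bracket p%:F q%:F = (p^`() * coef_der q - coef_der p * q^`())%:F.
Proof.
rewrite /bracket /tau_der /lam_der !(frac_derF (@derivM _)) !(frac_derF (@coef_derM k)).
by rewrite tofracB !tofracM.
Qed.

Lemma bracket_coordinates : bracket (polar_frac 'X_0) (polar_frac 'X_1) != 0.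
Proof.
rewrite /polar_frac bracketF polar0 polar1 tofrac_eq0 derivX mul1r coef_derM.
have -> : coef_der ('X : R2) = 0.
  by apply/polyP => i; rewrite coef_coef_der coefX coef0; case: eqP => _;
     rewrite ?deriv0 // -polyC1 derivC.
have -> : coef_der ('X%:P : R2) = 1.
  apply/polyP => i; rewrite coef_coef_der coefC coef1.
  by case: eqP; rewrite ?derivX ?deriv0.
by rewrite !mul0r subr0 add0r mulr1 polyX_eq0.
Qed.

(** The bracket with [u] is a derivation that kills the constants, so its kernel is a subalgebra. *)
Lemma bracket_subst2_eq0 (X Y : P2) (u : {fraction R2}) :
  bracket (polar_frac X) u = 0 -> bracket (polar_frac Y) u = 0 ->
  forall p, bracket (polar_frac (subst2 X Y p)) u = 0.
Proof.
move=> X0 Y0; elim/mpoly2_ind => [c|||p q hp hq|p q hp hq].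
- rewrite subst2C /polar_frac polarC; exact: bracket_scalar.
- by rewrite subst2_0.
- by rewrite subst2_1.
- rewrite [subst2 X Y _](rmorphD (subst2 X Y)) [polar_frac _](rmorphD polar_frac).
  by rewrite [LHS]bracketDl [X in X + _]hp [X in _ + X]hq addr0.
- rewrite [subst2 X Y _](rmorphM (subst2 X Y)) [polar_frac _](rmorphM polar_frac).
  rewrite [LHS]bracketMl [X in _ * X + _]hq [X in _ + _ * X]hp.
  by rewrite [X in X + _]mulr0 [X in _ + X]mulr0 addr0.
Qed.

(** If the bracket vanished on [X] and [Y] it would vanish on the subring they
    generate, which contains the coordinates. *)
Lemma bracket_aut_pair (X Y : P2) : aut_pair X Y ->
  bracket (polar_frac X) (polar_frac Y) != 0.
Proof.
move=> [inv _ invK]; apply: contraNneq bracket_coordinates => XY0.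
have zero p : bracket (polar_frac (subst2 X Y p)) (polar_frac X) = 0
           /\ bracket (polar_frac (subst2 X Y p)) (polar_frac Y) = 0.
  have YX0 : bracket (polar_frac Y) (polar_frac X) = 0 by rewrite bracketC XY0 oppr0.
  split; first exact: bracket_subst2_eq0 (bracketxx _) YX0 p.
  exact: bracket_subst2_eq0 XY0 (bracketxx _) p.
have [z0 z1] := zero (inv 'X_0); rewrite invK in z0 z1.
rewrite bracketC -[X in bracket (polar_frac X) _]invK; apply/eqP.
rewrite (bracket_subst2_eq0 _ _); first exact: oppr0.
  by rewrite bracketC z0 oppr0.
by rewrite bracketC z1 oppr0.
Qed.

(** A mere change of representation, to the iterated polynomials that [ev] takes; unlike [polar] it
    keeps the exponents. *)
Definition nested : P2 -> R2 := meval2 (@polyC {poly k} \o @polyC k) 'X 'X%:P.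
HB.instance Definition _ := GRing.RMorphism.copy nested
  (meval2 (@polyC {poly k} \o @polyC k) 'X 'X%:P).

Lemma ev_nested (X Y p : P2) :
  ev (@scalar k) (polar_frac X) (polar_frac Y) (nested p) = polar_frac (subst2 X Y p).
Proof.
apply: (@meval2_ext _ (ev (@scalar k) (polar_frac X) (polar_frac Y) \o nested)
                      (polar_frac \o subst2 X Y)) => [c||] /=.
- by rewrite subst2C /nested meval2C /= evC ev1C /polar_frac polarC.
- by rewrite subst2_0 /nested meval2_0 evX.
- by rewrite subst2_1 /nested meval2_1 evC ev1X.
Qed.

(** As [p > 1], the first variable cannot occur, and the second occurs at most linearly. *)
Lemma ev_flat (x y : {fraction R2}) (F : R2) (p q : nat) : (1 < p)%N -> (0 < q)%N ->
  (forall i j : nat, F`_i`_j != 0 -> (p * i + q * j <= 1)%N) ->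
  exists a b, ev (@scalar k) x y F = scalar a + scalar b * y.
Proof.
move=> p1 q0 flat; exists F`_0`_0, F`_0`_1.
have FE : F = (F`_0)%:P.
  apply/polyP => -[|i]; rewrite coefC //=; apply/polyP => j; rewrite coef0.
  apply/eqP; apply: contraTT isT => /flat.
  by move: p1; clear; nia.
have F0E : F`_0 = (F`_0`_0)%:P + F`_0`_1 *: 'X.
  apply/polyP => -[|[|j]]; rewrite coefD coefC coefZ coefX ?mulr0 ?mulr1 ?addr0 ?add0r //=.
  apply/eqP; apply: contraTT isT => /flat.
  by move: q0; clear; nia.
rewrite {1}FE evC {1}F0E rmorphD /= ev1C ev1Z ev1X //.
Qed.

Lemma msize_exp (p : P2) n : p != 0 -> msize (p ^+ n) = (n * (msize p).-1).+1.
Proof.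
move=> p0; elim: n => [|n IH]; first by rewrite expr0 -mpolyC1 mmeasureC oner_neq0.
rewrite exprS msizeM ?expf_neq0 // IH addnS /= mulSn.
by move: p0; rewrite -msize_poly_eq0 -lt0n; case: (msize p).
Qed.

Lemma tdeg_lt (p : P2) n : (0 < n)%N -> (tdeg p < n)%N = (msize p <= n)%N.
Proof. by rewrite /tdeg; case: (msize p). Qed.

Lemma tdeg_gt0_msize (p : P2) : (0 < tdeg p)%N -> msize p = (tdeg p).+1.
Proof. by rewrite /tdeg; case: (msize p). Qed.

Lemma tdeg_eq0 (p : P2) : tdeg p = 0%N -> exists c, p = c%:MP.
Proof.
move=> p0; exists p@_0%MM; apply/mpolyP => m; rewrite mcoeffC.
case: (eqVneq m 0%MM) => [->|m0]; first by rewrite mulr1.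
rewrite mulr0; apply: memN_msupp_eq0; apply/negP => /msize_mdeg_lt.
have : (0 < mdeg m)%N by rewrite lt0n mdeg_eq0.
by move: p0; rewrite /tdeg; clear; lia.
Qed.

Lemma aut_pairC (X Y : P2) : aut_pair X Y -> aut_pair Y X.
Proof.
move=> aut; have swap : aut_pair 'X_1 'X_0.
  by apply: (@inverse_aut_pair _ _ 'X_1 'X_0); rewrite ?subst2_0 ?subst2_1.
by have := aut_pair_comp aut swap; rewrite subst2_0 subst2_1.
Qed.

Lemma aut_pair_tdeg_gt0 (X Y : P2) : aut_pair X Y -> (0 < tdeg Y)%N.
Proof.
move=> aut; rewrite lt0n; apply/eqP => /tdeg_eq0[c Yc].
have := bracket_aut_pair aut; rewrite bracketC {}Yc /polar_frac polarC.
by rewrite bracket_scalar oppr0 eqxx.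
Qed.

(** [leading_forms_dependent] is applied to both components of the inverse. If both fell into the
    flat alternative, both coordinates would be affine in [Y] and their bracket would vanish. *)
Lemma jung_van_der_kulk (X Y : P2) : aut_pair X Y -> (1 < tdeg X)%N ->
  (tdeg Y <= tdeg X)%N ->
  exists (d : nat) (c : k), [/\ tdeg X = (d * tdeg Y)%N, c != 0
    & (tdeg (X - c *: Y ^+ d) < tdeg X)%N].
Proof.
move=> aut X1 YX; have Y0 := aut_pair_tdeg_gt0 aut.
have brXY := bracket_aut_pair aut; have [inv _ invK] := aut.
have sX : size (polar X) = (tdeg X).+1 by rewrite size_polar tdeg_gt0_msize // ltnW.
have sY : size (polar Y) = (tdeg Y).+1 by rewrite size_polar tdeg_gt0_msize.
(* The bracket is a nonzero polynomial, so its degree in tau is nonnegative. *)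
have brle : fval (bracket (polar X)%:F (polar Y)%:F) <= 0.
  rewrite bracketF fvalF; last by rewrite -tofrac_eq0 -bracketF.
  rewrite subr_le0 lez_nat size_poly_gt0 -tofrac_eq0 -bracketF //.
have U0 : exists2 U : R2, ev (@scalar k) (polar X)%:F (polar Y)%:F (nested (inv 'X_0)) = U%:F
    & size U = 2.
  exists 'X; last exact: size_polyX.
  by rewrite -polar0 -{2}[ 'X_0]invK; apply: ev_nested.
have U1 : exists2 U : R2, ev (@scalar k) (polar X)%:F (polar Y)%:F (nested (inv 'X_1)) = U%:F
    & size U = 2.
  exists (polar 'X_1); last by rewrite size_polar mmeasureX /= mdeg1.
  by rewrite -{2}[ 'X_1]invK; apply: ev_nested.
have [d [c [dE sdc]]] : exists (d : nat) (c : k), tdeg X = (d * tdeg Y)%N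
    /\ (size (polar Y ^+ d - c%:P%:P * polar X)%R <= tdeg X)%N.
  have [flat0|//] := leading_forms_dependent sX sY Y0 YX brXY brle U0.
  have [flat1|//] := leading_forms_dependent sX sY Y0 YX brXY brle U1.
  have [a [b E]] := ev_flat (polar_frac X) (polar_frac Y) X1 Y0 flat0.
  have [a' [b' E']] := ev_flat (polar_frac X) (polar_frac Y) X1 Y0 flat1.
  have := bracket_coordinates; rewrite -{1}[ 'X_0]invK -[ 'X_1]invK -!ev_nested E E'.
  rewrite bracketDl bracketMl !bracket_scalar mulr0 addr0 add0r.
  rewrite bracketC bracketDl bracketMl !bracket_scalar bracketxx !mulr0 !addr0 oppr0 mulr0.
  by rewrite eqxx.
have EE : polar Y ^+ d - c%:P%:P * polar X = polar (Y ^+ d - c *: X).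
  by rewrite rmorphB rmorphXn /= polarZ.
move: sdc; rewrite EE size_polar => sdc.
have Yn0 : Y != 0 by rewrite -msize_poly_eq0 tdeg_gt0_msize.
(* For [c = 0] nothing would be subtracted from [Y ^+ d], whose degree is exactly that of [X]. *)
have c0 : c != 0.
  apply: contraTneq sdc => ->; rewrite scale0r subr0 msize_exp // -/(tdeg Y) -dE.
  by rewrite -ltnNge.
exists d, c^-1; split=> //; first by rewrite invr_eq0.
rewrite tdeg_lt ?(ltnW X1) //.
have -> : X - c^-1 *: Y ^+ d = - c^-1 *: (Y ^+ d - c *: X).
  by rewrite scalerBr !scaleNr scalerA mulVf // scale1r opprK addrC.
by rewrite msizeZ // oppr_eq0 invr_eq0.
Qed.

End PlaneAutomorphisms.

(** * Counting automorphisms of given degree *)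

Section Counting.
Variable k : finFieldType.
Local Notation P2 := {mpoly k[2]}.
Local Notation q := #|k|.

(** A cardinality bound for a predicate not yet known to be finite. *)
Definition covered (T : eqType) (S : T -> Prop) (N : nat) : Prop :=
  exists2 s : seq T, (size s <= N)%N & forall x, S x -> x \in s.

Lemma coveredW (T : eqType) (S : T -> Prop) (M N : nat) :
  (M <= N)%N -> covered S M -> covered S N.
Proof. by move=> MN [s sM sS]; exists s => //; apply: leq_trans MN. Qed.

Lemma covered_pairs (L : eqType) (T T' : eqType) (l : seq L) (f : L -> T -> T')
    (S : T -> Prop) (S' : T' -> Prop) (N : nat) :
  (forall x, S' x -> exists2 a, a \in l & exists2 y, S y & x = f a y) ->
  covered S N -> covered S' (size l * N).
Proof.
move=> S'S [s sN sS]; exists [seq f a y | a <- l, y <- s].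
  by rewrite size_allpairs leq_mul2l sN orbT.
move=> x /S'S[a al [y Sy ->]]; apply: allpairs_f => //; exact: sS.
Qed.

Lemma covered_sum (I : eqType) (T : eqType) (r : seq I) (S : T -> Prop)
    (Sf : I -> T -> Prop) (N : I -> nat) :
  (forall x, S x -> exists2 i, i \in r & Sf i x) ->
  (forall i, i \in r -> covered (Sf i) (N i)) ->
  covered S (\sum_(i <- r) N i).
Proof.
elim: r S => [|i r IH] S hS hN.
  by exists [::] => // x /hS[].
have [s sN sS] : covered (fun x => S x /\ exists2 j, j \in r & Sf j x) (\sum_(j <- r) N j).
  by apply: IH => [x [] //|j jr]; apply: hN; rewrite inE jr orbT.
have [s' sN' sS'] := hN i (mem_head _ _).
exists (s' ++ s); first by rewrite size_cat big_cons leq_add.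
move=> x Sx; rewrite mem_cat; case: (hS _ Sx) => j; rewrite inE => /orP[/eqP ->|jr] Sjx.
  by rewrite sS'.
by rewrite sS ?orbT //; split=> //; exists j.
Qed.

(** * Shears and reduction of the degree *)

Definition poly_at (Y : P2) (h : {poly k}) : P2 := (map_poly (@mpolyC 2 k) h).[Y].
HB.instance Definition _ Y := GRing.RMorphism.copy (poly_at Y)
  (horner_eval Y \o map_poly (@mpolyC 2 k)).

Lemma poly_atZ Y c h : poly_at Y (c *: h) = c *: poly_at Y h.
Proof. by rewrite /poly_at map_polyZ hornerZ mul_mpolyC. Qed.

Lemma poly_atX Y : poly_at Y 'X = Y.
Proof. by rewrite /poly_at map_polyX hornerX. Qed.

Lemma poly_at_subst2 (X Y Z : P2) h : subst2 X Y (poly_at Z h) = poly_at (subst2 X Y Z) h.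
Proof.
rewrite -(coefK h) poly_def !rmorph_sum; apply: eq_bigr => i _ /=.
by rewrite !poly_atZ subst2Z; congr (_ *: _); rewrite !rmorphXn /= !poly_atX.
Qed.

Lemma aut_pair_shear (X Y : P2) (h : {poly k}) : aut_pair X Y -> aut_pair (X + poly_at Y h) Y.
Proof.
move=> aut; have shear : aut_pair ('X_0 + poly_at 'X_1 h : P2) 'X_1.
  apply: (@inverse_aut_pair _ _ _ ('X_0 - poly_at 'X_1 h) 'X_1); rewrite ?subst2_1 //.
    by rewrite rmorphB /= subst2_0 poly_at_subst2 subst2_1 addrK.
  by rewrite rmorphD /= subst2_0 poly_at_subst2 subst2_1 subrK.
have := aut_pair_comp aut shear.
by rewrite rmorphD /= subst2_0 poly_at_subst2 subst2_1.
Qed.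

(** [jung_van_der_kulk] is iterated as long as the first degree exceeds that of [Y]; the exponents
    decrease strictly and each is at least 2, so the removed terms add up to [h]. *)
Lemma reduce_aut_pair (X Y : P2) : aut_pair X Y -> (1 < tdeg X)%N -> (tdeg Y < tdeg X)%N ->
  exists (d : nat) (h : {poly k}) (Z : P2),
  [/\ tdeg X = (d * tdeg Y)%N, [/\ size h = d.+1, h`_0 = 0 & h`_1 = 0],
      X = Z + poly_at Y h, (tdeg Z <= tdeg Y)%N & aut_pair Z Y].
Proof.
have [n] := ubnP (tdeg X); elim: n X => // n IH X ltXn aut X1 YX.
have [d [c [dE c0 lt]]] := jung_van_der_kulk aut X1 (ltnW YX).
have Y0 := aut_pair_tdeg_gt0 aut.
have d1 : (1 < d)%N by move: YX; rewrite dE; move: Y0; clear; case: d => [|[|]]; lia.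
pose X' := X - c *: Y ^+ d.
have XE : X = X' + poly_at Y (c *: 'X^d).
  by rewrite poly_atZ rmorphXn /= poly_atX subrK.
have aut' : aut_pair X' Y.
  have := aut_pair_shear (- (c *: 'X^d)) aut.
  by rewrite rmorphN /= poly_atZ rmorphXn /= poly_atX.
have szc : size (c *: 'X^d) = d.+1 by rewrite size_scale // size_polyXn.
have coef_c i : (i < 2)%N -> (c *: 'X^d : {poly k})`_i = 0.
  by move=> i2; rewrite coefZ coefXn ltn_eqF ?mulr0 // (leq_trans i2).
have [leX'|ltX'] := leqP (tdeg X') (tdeg Y).
  by exists d, (c *: 'X^d), X'; split=> //; split=> //; apply: coef_c.
have [||||d' [h [Z [dE' [sh h0 h1] X'E leZ autZ]]]] := IH X'.
- by apply: leq_trans lt _; rewrite -ltnS.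
- exact: aut'.
- exact: leq_ltn_trans Y0 ltX'.
- exact: ltX'.
have ltd : (d' < d)%N by move: lt; rewrite -/X' dE dE' ltn_pmul2r.
exists d, (c *: 'X^d + h), Z; split=> //.
- split; first by rewrite size_polyDl szc // sh.
  + by rewrite coefD h0 coef_c ?addr0.
  + by rewrite coefD h1 coef_c ?addr0.
- by rewrite XE X'E rmorphD /= addrAC addrA.
Qed.

(** For [d > 1] and [c != 0] these are the polynomials of degree [d] without terms of degree below
    2; [t] lists the coefficients in degrees 2 to [d - 1]. *)
Definition tail_poly (d : nat) (c : k) (t : (d - 2).-tuple k) : {poly k} :=
  c *: 'X^d + 'X^2 * Poly t.

Lemma coef_tail_poly d c (t : (d - 2).-tuple k) i :
  (tail_poly c t)`_i = c * (i == d)%:R + (if (i < 2)%N then 0 else t`_(i - 2)).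
Proof. by rewrite coefD coefZ coefXn coefXnM coef_Poly. Qed.

Lemma size_tail_poly d c (t : (d - 2).-tuple k) : (1 < d)%N -> c != 0 ->
  size (tail_poly c t) = d.+1.
Proof.
move=> d1 c0; rewrite size_polyDl size_scale // size_polyXn // ltnS.
apply/leq_sizeP => j dj; rewrite coefXnM coef_Poly; case: ifP => // _.
by rewrite nth_default // size_tuple leq_sub2r.
Qed.

Definition tail_polys (d : nat) : seq {poly k} :=
  [seq tail_poly c t | c <- enum (predC1 (0 : k)), t <- enum {:(d - 2).-tuple k}].

Lemma size_tail_polys d : size (tail_polys d) = (q.-1 * q ^ (d - 2))%N.
Proof. by rewrite size_allpairs -!cardE cardC1 card_tuple. Qed.

Lemma mem_tail_polys d (h : {poly k}) : (1 < d)%N -> size h = d.+1 -> h`_0 = 0 -> h`_1 = 0 ->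
  h \in tail_polys d.
Proof.
move=> d1 sh h0 h1.
pose t := [tuple h`_(i + 2) | i < d - 2].
have -> : h = tail_poly h`_d t.
  apply/polyP => i; rewrite coef_tail_poly.
  have [i2|i2] := ltnP i 2.
    rewrite ltn_eqF ?mulr0 ?addr0; last exact: leq_trans d1.
    by case: i i2 => [|[]].
  have [->|id] := eqVneq i d.
    by rewrite mulr1 [X in _ + X]nth_default ?addr0 // size_tuple.
  rewrite mulr0 add0r; have [ltid|ledi] := ltnP i d.
    have lti : (i - 2 < d - 2)%N by rewrite ltn_sub2r // (leq_ltn_trans i2).
    by rewrite -(tnth_nth 0 t (Ordinal lti)) tnth_mktuple /= subnK.
  rewrite !nth_default // ?size_tuple ?leq_sub2r // sh.
  by rewrite ltn_neqAle eq_sym id.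
apply: allpairs_f; last by rewrite mem_enum.
by rewrite mem_enum inE /= -[d]/(d.+1.-1) -sh -lead_coefE lead_coef_eq0 -size_poly_eq0 sh.
Qed.

(** The first two kinds alternate in the recursion: a strict pair of degree [n > 1] is a shear of a
    capped pair of smaller degree dividing [n], and a capped pair of degree [n > 1] is a linear
    recombination of a strict pair of the same degree. *)
Definition strict_pair (n : nat) (xy : P2 * P2) : Prop :=
  [/\ aut_pair xy.1 xy.2, tdeg xy.1 = n & (tdeg xy.2 < n)%N].
Definition capped_pair (n : nat) (xy : P2 * P2) : Prop :=
  [/\ aut_pair xy.1 xy.2, tdeg xy.2 = n & (tdeg xy.1 <= n)%N].
Definition degree_pair (n : nat) (xy : P2 * P2) : Prop :=
  aut_pair xy.1 xy.2 /\ maxn (tdeg xy.1) (tdeg xy.2) = n.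

(** If the degrees agree, the exponent in [jung_van_der_kulk] is 1, so a multiple of [Y] removes the
    leading form of [X]. *)
Lemma capped_pair_reduce (X Y : P2) (n : nat) : (1 < n)%N -> aut_pair X Y -> tdeg Y = n ->
  (tdeg X <= n)%N -> exists a, strict_pair n (Y, X - a *: Y).
Proof.
move=> n1 aut Yn; rewrite leq_eqVlt => /orP[/eqP Xn|ltX]; last first.
  by exists 0; rewrite scale0r subr0; split; [exact: aut_pairC|exact: Yn|exact: ltX].
have X1 : (1 < tdeg X)%N by rewrite Xn.
have YX : (tdeg Y <= tdeg X)%N by rewrite Xn Yn.
have [d [c [dE c0]]] := jung_van_der_kulk aut X1 YX; rewrite Xn Yn in dE *.
have -> : d = 1%N by move: dE n1; clear; nia.
rewrite expr1 => lt; exists c; split; [apply: aut_pairC|exact: Yn|exact: lt].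
have := aut_pair_shear (- (c *: 'X)) aut.
by rewrite rmorphN /= poly_atZ poly_atX.
Qed.

Lemma covered_capped_pair n N : (1 < n)%N ->
  covered (strict_pair n) N -> covered (capped_pair n) (q * N).
Proof.
move=> n1; rewrite cardE.
apply: (@covered_pairs _ _ _ _ (fun a (yx : P2 * P2) => (yx.2 + a *: yx.1, yx.1))).
move=> [X Y] [/= aut Yn Xn]; have [a Ua] := capped_pair_reduce n1 aut Yn Xn.
exists a; first by rewrite mem_enum.
by exists (Y, X - a *: Y) => //=; rewrite subrK.
Qed.

(** The factor counts the points of the projective line over [k]: [None] swaps the components,
    [Some a] adds [a] times the first to the second. *)
Lemma covered_degree_pair n N : (1 < n)%N ->
  covered (strict_pair n) N -> covered (degree_pair n) (q.+1 * N).
Proof.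
move=> n1; rewrite -card_option cardE.
apply: (@covered_pairs _ _ _ _ (fun o (xy : P2 * P2) =>
  if o is Some a then (xy.1, xy.2 + a *: xy.1) else (xy.2, xy.1))).
move=> [X Y] [/= aut mx]; have [ltX|leX] := ltnP (tdeg X) (tdeg Y).
  exists None; first by rewrite mem_enum.
  exists (Y, X); last by [].
  by split; [exact: aut_pairC |
    rewrite -mx (maxn_idPr (ltnW ltX)) | rewrite -mx (maxn_idPr (ltnW ltX))].
have Xn : tdeg X = n by rewrite -mx (maxn_idPl leX).
have [|a Ua] := @capped_pair_reduce Y X n n1 (aut_pairC aut) Xn; first by rewrite -Xn.
exists (Some a); first by rewrite mem_enum.
by exists (X, Y - a *: X) => //=; rewrite subrK.
Qed.

Lemma covered_strict_pair n (N : nat -> nat) : (1 < n)%N ->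
  (forall b, (b %| n)%N -> (b < n)%N -> covered (capped_pair b) (N b)) ->
  covered (strict_pair n)
    (\sum_(b <- [seq b <- divisors n | (b < n)%N]) (q.-1 * q ^ (n %/ b - 2)) * N b).
Proof.
move=> n1 hN; have n0 : (0 < n)%N by apply: ltnW.
apply: (@covered_sum _ _ _ _ (fun b xy => strict_pair n xy /\ tdeg xy.2 = b)).
  move=> [X Y] U; exists (tdeg Y); last by [].
  have [aut Xn Yn] := U; rewrite mem_filter Yn -dvdn_divisors //=.
  have X1 : (1 < tdeg X)%N by rewrite Xn.
  have YX : (tdeg Y < tdeg X)%N by rewrite Xn.
  have [d [h [Z [dE _ _ _ _]]]] := reduce_aut_pair aut X1 YX.
  by rewrite -Xn dE dvdn_mull.
move=> b; rewrite mem_filter -dvdn_divisors // => /andP[bn bdvd].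
rewrite -size_tail_polys.
apply: (@covered_pairs _ _ _ _ (fun h (zy : P2 * P2) => (zy.1 + poly_at zy.2 h, zy.2))
  (capped_pair b)); last exact: hN.
move=> [X Y] [[/= aut Xn Yn] Yb].
have b0 : (0 < b)%N by rewrite -Yb (aut_pair_tdeg_gt0 aut).
have X1 : (1 < tdeg X)%N by rewrite Xn.
have YX : (tdeg Y < tdeg X)%N by rewrite Xn.
have [d [h [Z [dE [sh h0 h1] XE leZ autZ]]]] := reduce_aut_pair aut X1 YX.
have dn : (n %/ b = d)%N by rewrite -Xn dE Yb mulnK.
exists h; last by exists (Z, Y); rewrite /= -?XE //; split=> //=; rewrite -Yb.
rewrite dn; apply: mem_tail_polys => //.
by move: bn b0; rewrite -Xn dE Yb; clear; nia.
Qed.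

(** * Affine automorphisms *)

Definition affine_form (M : 'M[k]_2) (v : 'rV[k]_2) (i : 'I_2) : P2 :=
  M i 0 *: 'X_0 + M i 1 *: 'X_1 + (v 0 i)%:MP.

Lemma polar_frac_aff M v i : polar_frac (affine_form M v i) =
  scalar (M i 0) * polar_frac 'X_0 + scalar (M i 1) * polar_frac 'X_1 + scalar (v 0 i).
Proof.
by rewrite /polar_frac /affine_form !(rmorphD (@polar k)) /= !polarZ polarC !tofracD !tofracM.
Qed.

Lemma sum_ord2 (A : nmodType) (f : 'I_2 -> A) : \sum_i f i = f 0 + f 1.
Proof.
rewrite big_ord_recl big_ord1; congr (f _ + f _); exact: val_inj.
Qed.

Lemma subst2_aff M v N w i :
  subst2 (affine_form N w 0) (affine_form N w 1) (affine_form M v i) =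
  affine_form (M *m N) (w *m M^T + v) i.
Proof.
rewrite [in LHS]/(affine_form M v i); set S := subst2 _ _.
have -> : S (M i 0 *: 'X_0 + M i 1 *: 'X_1 + (v 0 i)%:MP) =
    M i 0 *: affine_form N w 0 + M i 1 *: affine_form N w 1 + (v 0 i)%:MP.
  by rewrite [LHS]rmorphD [X in X + _ = _]rmorphD /= /S !subst2Z subst2_0 subst2_1 subst2C.
rewrite {S} /affine_form !mxE !sum_ord2 !mxE.
rewrite !scalerDr !scalerDl !scalerA -!mul_mpolyC !mpolyCD !mpolyCM.
move: ('X_0 : P2) ('X_1 : P2) => x y; ring.
Qed.

Lemma aff1 i : affine_form 1%:M 0 i = 'X_i.
Proof.
rewrite /affine_form !mxE; case: (ord2P i) => -> /=; rewrite ?eqxx mpolyC0 addr0.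
  by rewrite scale1r scale0r addr0.
by rewrite scale0r scale1r add0r.
Qed.

Lemma aut_pair_aff M v : M \in unitmx -> aut_pair (affine_form M v 0) (affine_form M v 1).
Proof.
move=> uM; pose N := invmx M; pose w := - (v *m N^T).
have E1 : w *m M^T + v = 0.
  by rewrite mulNmx -mulmxA -trmx_mul mulmxV // trmx1 mulmx1 addNr.
have E2 : v *m N^T + w = 0 by rewrite subrr.
apply: (@inverse_aut_pair _ _ _ (affine_form N w 0) (affine_form N w 1)).
- by rewrite subst2_aff mulVmx // E2 aff1.
- by rewrite subst2_aff mulVmx // E2 aff1.
- by rewrite subst2_aff mulmxV // E1 aff1.
- by rewrite subst2_aff mulmxV // E1 aff1.
Qed.

Lemma tdeg_aff_le M v i : (tdeg (affine_form M v i) <= 1)%N.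
Proof.
have le2 p r : (msize p <= 2)%N -> (msize r <= 2)%N -> (msize (p + r : P2) <= 2)%N.
  by move=> hp hr; apply: leq_trans (msizeD_le _ _) _; rewrite geq_max hp.
have leX a j : (msize (a *: 'X_j : P2) <= 2)%N.
  have [->|a0] := eqVneq a 0; first by rewrite scale0r mmeasure0.
  by rewrite msizeZ // mmeasureX /= mdeg1.
suff : (msize (affine_form M v i) <= 2)%N by rewrite /tdeg; case: (msize _).
apply: (le2); first by apply: (le2); apply: leX.
by rewrite mmeasureC; case: eqP.
Qed.

Lemma mcoeff_aff M v i : [/\ (affine_form M v i)@_U_(0) = M i 0, (affine_form M v i)@_U_(1) = M i 1
  & (affine_form M v i)@_0%MM = v 0 i].
Proof.
have E (m : 'X_{1..2}) : (affine_form M v i)@_m =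
    M i 0 * (U_(0%R)%MM == m)%:R + M i 1 * (U_(1%R)%MM == m)%:R + v 0 i * (m == 0%MM)%:R.
  by rewrite /affine_form !mcoeffD !mcoeffZ !mcoeffX mcoeffC.
by rewrite !E !eq_mnm1 !mnm1_eq0 !eqxx /= !mulr1 !mulr0 !addr0 !add0r.
Qed.

Lemma aff_inj M v M' v' :
  (forall i, affine_form M v i = affine_form M' v' i) -> M = M' /\ v = v'.
Proof.
move=> E; split; apply/matrixP => i j.
  have [e0 e1 _] := mcoeff_aff M v i; have [f0 f1 _] := mcoeff_aff M' v' i.
  by case: (ord2P j) => ->; rewrite -?e0 -?e1 E.
have [_ _ e] := mcoeff_aff M v j; have [_ _ f] := mcoeff_aff M' v' j.
by rewrite ord1 -e E f.
Qed.

Lemma tdeg_le1_aff (X Y : P2) : (tdeg X <= 1)%N -> (tdeg Y <= 1)%N ->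
  exists M v, X = affine_form M v 0 /\ Y = affine_form M v 1.
Proof.
move=> X1 Y1; pose Z (i : 'I_2) := if i == 0 then X else Y.
have Z1 i : (tdeg (Z i) <= 1)%N by rewrite /Z; case: eqP.
exists (\matrix_(i, j) (Z i)@_U_(j)), (\row_i (Z i)@_0%MM).
suff ZE i : Z i = affine_form (\matrix_(i, j) (Z i)@_U_(j)) (\row_i (Z i)@_0%MM) i.
  by split; rewrite -ZE.
apply/mpolyP => m; rewrite /affine_form !mcoeffD !mcoeffZ !mcoeffX mcoeffC !mxE.
have [m2|] := ltnP 1 (mdeg m).
  have m0 : m != 0%MM by rewrite -mdeg_eq0 -lt0n ltnW.
  have mU j : U_(j)%MM != m by apply: contraTneq m2 => <-; rewrite mdeg1.
  rewrite (negPf m0) !(negPf (mU _)) !mulr0 !addr0.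
  apply: memN_msupp_eq0; apply: msize_mdeg_ge.
  apply: leq_trans m2; move: (Z1 i); rewrite /tdeg.
  by case: (msize (Z i)) => [|[|[]]].
rewrite leq_eqVlt ltnS leqn0 mdeg_eq0 => /orP[/mdeg1P[j /eqP ->]|/eqP ->].
  by rewrite !eq_mnm1 mnm1_eq0; case: (ord2P j) => ->; rewrite /= ?mulr0 ?mulr1 ?addr0 ?add0r.
by rewrite !mnm1_eq0 eqxx !mulr0 mulr1 !add0r.
Qed.

Lemma bracket_affine (a b c a' b' c' : k) (x y : {fraction {poly {poly k}}}) :
  bracket (scalar a * x + scalar b * y + scalar c) (scalar a' * x + scalar b' * y + scalar c')
  = scalar (a * b' - b * a') * bracket x y.
Proof.
have brl e f g (u : {fraction {poly {poly k}}}) :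
    bracket (scalar e * x + scalar f * y + scalar g) u =
    scalar e * bracket x u + scalar f * bracket y u.
  by rewrite !(bracketDl, bracketMl) !bracket_scalar !mulr0 !addr0.
rewrite brl [bracket x _]bracketC [bracket y _]bracketC !brl !bracketxx (bracketC y x).
rewrite rmorphB !rmorphM /=.
have cramer (L : comNzRingType) (u v u' v' w : L) :
    u * - (u' * 0 + v' * - w) + v * - (u' * w + v' * 0) = (u * v' - v * u') * w by ring.
exact: cramer.
Qed.

Lemma det2E (M : 'M[k]_2) : \det M = M 0 0 * M 1 1 - M 0 1 * M 1 0.
Proof.
rewrite (expand_det_row _ 0) sum_ord2 /cofactor !det_mx11 !mxE /=.
rewrite !expr0 expr1 mul1r mulN1r mulrN.
have -> : lift 0 0 = 1 :> 'I_2 by apply: val_inj.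
by have -> : lift 1 0 = 0 :> 'I_2 by apply: val_inj.
Qed.

(** The bracket of the pair is [\det M] times that of the coordinates and does not vanish for an
    automorphism. *)
Lemma aff_aut_pair_unitmx M v : aut_pair (affine_form M v 0) (affine_form M v 1) -> M \in unitmx.
Proof.
move=> aut; have := bracket_aut_pair aut; rewrite !polar_frac_aff.
rewrite unitmxE unitfE; apply: contraNneq => det0.
have {}det0 : M 0 0 * M 1 1 - M 0 1 * M 1 0 = 0.
  by rewrite -det2E.
by rewrite bracket_affine det0 rmorph0 mul0r.
Qed.

(** The order of ['GL_2[k]] times the [q ^ 2] translations. *)
Definition num_affine : nat := (q * q.-1 ^ 2 * q.+1 * q ^ 2)%N.

Lemma card_affine : #|{: {'GL_2[k]} * 'rV[k]_2}| = num_affine.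
Proof.
rewrite card_prod card_mx mul1n; congr (_ * _)%N.
by rewrite -(card_GL_2 k) cardsT.
Qed.

Definition affine_pair (uv : {'GL_2[k]} * 'rV[k]_2) : P2 * P2 :=
  let M : 'M[k]_2 := GLval uv.1 in (affine_form M uv.2 0, affine_form M uv.2 1).

Lemma covered_capped_pair1 : covered (capped_pair 1) num_affine.
Proof.
exists [seq affine_pair uv | uv <- enum {: {'GL_2[k]} * 'rV[k]_2}].
  by rewrite size_map -cardE card_affine.
move=> [X Y] [/= aut Y1 X1]; have Yle : (tdeg Y <= 1)%N by rewrite Y1.
have [M [v [XE YE]]] := tdeg_le1_aff X1 Yle.
have uM : M \in unitmx by apply: (@aff_aut_pair_unitmx M v); rewrite -XE -YE.
apply/mapP; exists (FinRing.Unit (uM : (M : 'M[k]_2.-1.+1) \is a GRing.unit), v).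
  by rewrite mem_enum.
by rewrite XE YE.
Qed.

End Counting.

(** * Injective parametrization for the lower bound *)

Section LowerBound.
Variable k : finFieldType.
Local Notation P2 := {mpoly k[2]}.
Local Notation q := #|k|.

Lemma tdeg_polar (p : P2) : tdeg p = (size (polar p)).-1.
Proof. by rewrite size_polar. Qed.

Lemma tdegDr (p r : P2) : (tdeg p < tdeg r)%N -> tdeg (p + r) = tdeg r.
Proof.
rewrite !tdeg_polar (rmorphD (@polar k)) /= => ltpr.
rewrite addrC size_polyDl //.
have pred_lt a b : (a.-1 < b.-1)%N -> (a < b)%N by case: a b => [|a] [|b].
exact: pred_lt ltpr.
Qed.

(** [polar] turns evaluation at [Y] into composition of univariate polynomials over a domain. *)
Lemma tdeg_poly_at (Y : P2) (h : {poly k}) : tdeg (poly_at Y h) = ((size h).-1 * tdeg Y)%N.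
Proof.
have polar_at : polar (poly_at Y h) = map_poly polyC h \Po polar Y.
  rewrite -{1}(coefK h) poly_def !rmorph_sum /=.
  rewrite -[in RHS](coefK h) poly_def !rmorph_sum.
  apply: eq_bigr => i _ /=; rewrite poly_atZ polarZ map_polyZ comp_polyZ.
  rewrite map_polyXn comp_Xn_poly rmorphXn /= poly_atX rmorphXn /=.
  by rewrite mul_polyC.
rewrite !tdeg_polar polar_at size_comp_poly size_map_inj_poly ?rmorph0 //.
exact: polyC_inj.
Qed.

Lemma tdegZ_lt (a : k) (X : P2) n : (0 < n)%N -> tdeg X = n -> (tdeg (a *: X) < n)%N -> a = 0.
Proof.
move=> n0 Xn; apply: contraTeq => a0; rewrite -leqNgt -Xn leq_eqVlt.
by rewrite /tdeg msizeZ // eqxx.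
Qed.

Lemma tdegB_lt (p r : P2) n : (tdeg p < n)%N -> (tdeg r < n)%N -> (tdeg (p - r) < n)%N.
Proof.
move=> hp; have n0 : (0 < n)%N by apply: leq_ltn_trans hp.
move: hp; rewrite !tdeg_lt // => hp hr.
by apply: leq_trans (msizeD_le _ _) _; rewrite geq_max hp mmeasureN.
Qed.

Lemma tail_poly_inj d (c c' : k) (t t' : (d - 2).-tuple k) : (1 < d)%N ->
  tail_poly c t = tail_poly c' t' -> c = c' /\ t = t'.
Proof.
move=> d1 E; split.
  move: (congr1 (fun p : {poly k} => p`_d) E); rewrite !coef_tail_poly eqxx ltnNge d1 /=.
  by rewrite !mulr1 !nth_default ?size_tuple // !addr0.
apply: val_inj; apply: (@eq_from_nth _ 0); rewrite ?size_tuple // => i lti.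
move: (congr1 (fun p : {poly k} => p`_(i + 2)) E); rewrite !coef_tail_poly.
rewrite ltnNge leq_addl addnK ltn_eqF ?mulr0 ?add0r //.
by move: lti; clear; lia.
Qed.

Definition base_pair (Z Y : P2) (h : {poly k}) : P2 * P2 := (Z + poly_at Y h, Y).

Definition recombine (o : option k) (xy : P2 * P2) : P2 * P2 :=
  if o is Some a then (xy.1, xy.2 + a *: xy.1) else (xy.2, xy.1).

Lemma aut_pair_recombine o xy :
  aut_pair xy.1 xy.2 -> aut_pair (recombine o xy).1 (recombine o xy).2.
Proof.
move=> aut; case: o => [a|] /=; last exact: aut_pairC.
have := aut_pair_shear (a *: 'X) (aut_pairC aut).
by rewrite poly_atZ poly_atX => /aut_pairC.
Qed.

Lemma tdeg_recombine o xy n : tdeg xy.1 = n -> (tdeg xy.2 < n)%N ->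
  maxn (tdeg (recombine o xy).1) (tdeg (recombine o xy).2) = n.
Proof.
move=> Xn Yn; case: o => [a|] /=; last by rewrite Xn (maxn_idPr (ltnW Yn)).
rewrite Xn; apply/maxn_idPl; have n0 : (0 < n)%N by apply: leq_ltn_trans Yn.
have : (tdeg (xy.2 + a *: xy.1) < n.+1)%N.
  rewrite -[a *: xy.1]opprK -scaleNr; apply: tdegB_lt; first exact: ltnW.
  rewrite tdeg_lt //; have [->|a0] := eqVneq (- a) 0; first by rewrite scale0r mmeasure0.
  by rewrite msizeZ // tdeg_gt0_msize ?Xn.
by rewrite ltnS.
Qed.

(** Two values [a], [a'] would give [(a - a') *: X = Y' - Y] of degree below [n], so they agree; a
    swap is recognized by the degree of the first component. *)
Lemma recombine_inj o o' xy xy' n : tdeg xy.1 = n -> (tdeg xy.2 < n)%N ->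
  tdeg xy'.1 = n -> (tdeg xy'.2 < n)%N -> recombine o xy = recombine o' xy' -> o = o' /\ xy = xy'.
Proof.
move: xy xy' => [X Y] [X' Y'] /= Xn Yn Xn' Yn'.
have n0 : (0 < n)%N by apply: leq_ltn_trans Yn.
case: o => [a|]; case: o' => [a'|] /= oo; move: (congr1 fst oo) (congr1 snd oo) => /= {oo}.
- move=> <- E; have aa : a - a' = 0.
    apply: (tdegZ_lt n0 Xn); rewrite scalerBl (_ : _ - _ = Y' - Y); first exact: tdegB_lt.
    have -> : Y' = Y + (a *: X - a' *: X) by rewrite addrA E addrK.
    by rewrite [Y + _]addrC addrK.
  have ea : a = a' by apply/eqP; rewrite -subr_eq0 aa.
  by move: E; rewrite ea => /addIr ->.
- by move=> E _; move: Yn'; rewrite -E Xn ltnn.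
- by move=> E _; move: Yn; rewrite E Xn' ltnn.
- by move=> -> ->.
Qed.

(** The difference of the two tails, evaluated at [Y] of degree 1, equals [Z' - Z] of degree at most
    1; having no terms of degree below 2, it is zero. *)
Lemma base_pair_inj (Z Y Z' Y' : P2) (d : nat) (c c' : k) (t t' : (d - 2).-tuple k) :
  (1 < d)%N -> c != 0 -> c' != 0 ->
  tdeg Y = 1%N -> (tdeg Z <= 1)%N -> (tdeg Z' <= 1)%N ->
  base_pair Z Y (tail_poly c t) = base_pair Z' Y' (tail_poly c' t') ->
  [/\ Z = Z', Y = Y', c = c' & t = t'].
Proof.
move=> d1 c0 c0' Y1 Z1 Z1' pp; move: (congr1 fst pp) (congr1 snd pp) => /= E YE.
rewrite -{}YE in E *.
have hh : poly_at Y (tail_poly c t - tail_poly c' t') = Z' - Z.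
  rewrite rmorphB /=; apply/eqP; rewrite subr_eq addrAC -E [Z + _]addrC.
  by rewrite addrK.
have : (tdeg (poly_at Y (tail_poly c t - tail_poly c' t')%R) < 2)%N.
  by rewrite hh; apply: tdegB_lt; rewrite ltnS.
rewrite tdeg_poly_at Y1 muln1 => s2.
have hE : tail_poly c t = tail_poly c' t'.
  apply/eqP; rewrite -subr_eq0; apply/eqP/polyP => i; rewrite coef0.
  have [i2|i2] := ltnP i 2.
    by rewrite coefB !coef_tail_poly i2 ltn_eqF ?(leq_trans i2) // !mulr0 subrr.
  apply: nth_default; apply: leq_trans i2.
  by move: s2; case: (size _).
have [cE tE] := tail_poly_inj d1 hE; split=> //.
by move: E; rewrite hE => /addIr.
Qed.

(** Parameters of the automorphisms of degree [n] with a single nonlinear factor: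
    a point of the projective line, the nonlinear part, and an affine automorphism. *)
Definition params (n : nat) : finType :=
  ((option k * {c : k | c != 0}) * ((n - 2).-tuple k * ({'GL_2[k]} * 'rV[k]_2)))%type.

Definition param_pair (n : nat) (x : params n) : P2 * P2 :=
  recombine x.1.1 (base_pair (affine_pair x.2.2).1 (affine_pair x.2.2).2
              (tail_poly (val x.1.2) x.2.1)).

Lemma card_params n : #|params n| = (q.+1 * q.-1 * (q ^ (n - 2) * num_affine k))%N.
Proof.
rewrite -(card_affine k) !card_prod card_option card_tuple; congr (_ * _ * _)%N.
by rewrite card_sig -(cardC1 (0 : k)); apply: eq_card.
Qed.

Lemma aut_pair_affine_pair (uv : {'GL_2[k]} * 'rV[k]_2) :
  aut_pair (affine_pair uv).1 (affine_pair uv).2.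
Proof. exact: aut_pair_aff (GL_unitmx uv.1). Qed.

Lemma tdeg_affine_pair2 (uv : {'GL_2[k]} * 'rV[k]_2) : tdeg (affine_pair uv).2 = 1%N.
Proof.
apply/eqP; rewrite eqn_leq tdeg_aff_le.
exact: aut_pair_tdeg_gt0 (aut_pair_affine_pair uv).
Qed.

Lemma tdeg_param_base n (c : k) (t : (n - 2).-tuple k)
    (uv : {'GL_2[k]} * 'rV[k]_2) : (1 < n)%N -> c != 0 ->
  tdeg (base_pair (affine_pair uv).1 (affine_pair uv).2 (tail_poly c t)).1 = n.
Proof.
move=> n1 c0; have hn : tdeg (poly_at (affine_pair uv).2 (tail_poly c t)) = n.
  by rewrite tdeg_poly_at size_tail_poly // tdeg_affine_pair2 muln1.
by rewrite tdegDr hn //; apply: leq_ltn_trans n1; apply: tdeg_aff_le.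
Qed.

Lemma param_pair_T n x : (1 < n)%N -> degree_pair n (@param_pair n x).
Proof.
move: x => [[o [c c0]] [t uv]] n1.
have b1 := tdeg_param_base t uv n1 c0.
split; first by apply: aut_pair_recombine; apply: aut_pair_shear; apply: aut_pair_affine_pair.
by apply: tdeg_recombine => //=; rewrite tdeg_affine_pair2.
Qed.

Lemma param_pair_inj n : (1 < n)%N -> injective (@param_pair n).
Proof.
move=> n1 [[o [c c0]] [t [u v]]] [[o' [c' c0']] [t' [u' v']]]; rewrite /param_pair.
have b1 := tdeg_param_base t (u, v) n1 c0; have b2 := tdeg_param_base t' (u', v') n1 c0'.
have y1 : (tdeg (affine_pair (u, v)).2 < n)%N by rewrite tdeg_affine_pair2.
have y2 : (tdeg (affine_pair (u', v')).2 < n)%N by rewrite tdeg_affine_pair2.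
move=> E; have [/= -> {}E] := recombine_inj b1 y1 b2 y2 E.
have [E0 E1 /= cE tE] := base_pair_inj n1 c0 c0' (tdeg_affine_pair2 (u, v))
  (tdeg_aff_le _ _ _) (tdeg_aff_le _ _ _) E.
have [uE vE] : (GLval u : 'M[k]_2) = GLval u' /\ v = v'.
  by apply: aff_inj => i; case: (ord2P i) => ->.
congr (_, _, (_, (_, _))) => //; first exact: val_inj.
exact: val_inj.
Qed.

End LowerBound.

End JungVanDerKulk.

From mathcomp Require Import boolp classical_sets functions cardinality.

(** * Ordered factorizations *)

Module Count.
Import finmap mpoly JungVanDerKulk.
Set Implicit Arguments.
Unset Strict Implicit.
Unset Printing Implicit Defensive.
Import Order.TTheory GRing.Theory Num.Theory.
Local Open Scope ring_scope.

(** Number of ways to write [n] as an ordered product of [m] factors; factors equal to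
    [1] are allowed, so that this also bounds the number of shorter factorizations. *)
Fixpoint ordered_factorizations (m n : nat) : nat :=
  if m is m'.+1 then \sum_(b <- divisors n) ordered_factorizations m' b else n == 1%N.

Local Notation tau := ordered_factorizations.

Lemma tau1 m : tau m 1 = 1%N.
Proof. by elim: m => //= m IH; rewrite big_cons big_nil IH. Qed.

Lemma leq_sum_subset (r s : seq nat) (f : nat -> nat) : uniq r -> {subset r <= s} ->
  (\sum_(b <- r) f b <= \sum_(b <- s) f b)%N.
Proof.
elim: r s => [|x r IH] s /=; first by rewrite big_nil.
move=> /andP[xr ur] rs; have xs : x \in s by apply: rs; rewrite mem_head.
rewrite big_cons (perm_big _ (perm_to_rem xs)) big_cons leq_add2l IH // => y yr.
have ys : y \in s by apply: rs; rewrite inE yr orbT.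
have yx : y != x by apply: contraNneq xr => <-.
by have := perm_mem (perm_to_rem xs) y; rewrite ys inE (negPf yx).
Qed.

(** The prime [p] has to be absorbed by one of the [m] factors. *)
Lemma tau_prime_mul m p n : prime p -> (0 < n)%N -> (tau m (p * n) <= m * tau m n)%N.
Proof.
move=> pp; elim: m n => [|m IH] n n0.
  rewrite /= mul0n leqn0 eqb0; apply/eqP => /eqP; rewrite muln_eq1 => /andP[/eqP p1].
  by rewrite p1 in pp.
have p0 := prime_gt0 pp.
rewrite /= mulSn.
(* A divisor of [p * n] divides [n] or is [p] times a divisor of [n]. *)
apply: (@leq_trans (\sum_(b <- divisors n ++ [seq (p * b)%N | b <- divisors n]) tau m b)).
  apply: leq_sum_subset; first exact: divisors_uniq.
  move=> b; rewrite mem_cat -!dvdn_divisors ?muln_gt0 ?p0 // => bpn.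
  have [pb|npb] := boolP (p %| b)%N; apply/orP; [right|left].
    apply/mapP; exists (b %/ p)%N; last by rewrite mulnC divnK.
    by rewrite -dvdn_divisors // -(dvdn_pmul2l p0) mulnC divnK.
  by rewrite -(Gauss_dvdr (m := b) (n := p)) // coprime_sym prime_coprime.
rewrite big_cat leq_add2l big_map big_distrr /=.
rewrite big_seq [leqRHS]big_seq; apply: leq_sum => b bn; apply: IH.
by apply: (dvdn_gt0 n0); rewrite dvdn_divisors.
Qed.

(** Each prime divided out costs a factor [m] and at least halves [n]. *)
Lemma tau_le m e n : (0 < n < 2 ^ e.+1)%N -> (0 < m)%N -> (tau m n <= m ^ e)%N.
Proof.
elim: e n => [|e IH] n /andP[n0 ltn] m0.
  have -> : n = 1%N by move: n0 ltn; rewrite expn1; clear; lia.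
  by rewrite tau1.
have [n1|n1] := leqP n 1.
  have -> : n = 1%N by move: n0 n1; clear; lia.
  by rewrite tau1 expn_gt0 m0.
have pp := pdiv_prime n1; have pd := pdiv_dvd n; have p2 := prime_gt1 pp.
have d0 : (0 < n %/ pdiv n)%N by rewrite divn_gt0 ?prime_gt0 // pdiv_leq.
have nE : n = (pdiv n * (n %/ pdiv n))%N by rewrite mulnC divnK.
rewrite [X in tau m X]nE.
apply: leq_trans (tau_prime_mul _ pp d0) _; rewrite expnS leq_mul2l; apply/orP; right.
apply: IH => //; rewrite d0 /= ltn_divLR ?prime_gt0 //.
apply: leq_trans ltn _; rewrite [(2 ^ e.+2)%N]expnS mulnC leq_mul2l p2 orbT //.
Qed.

(** * The recursion for the upper bound *)

Section UpperBound.
Variable k : finFieldType.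
Local Notation q := #|k|.
Local Notation C := (num_affine k * q.-1)%N.

Definition capped_bound (m b : nat) : nat :=
  if b == 1%N then num_affine k else (q * (C * q ^ (b - 2) * tau m b))%N.

Lemma q_gt0 : (0 < q)%N.
Proof. by apply/card_gt0P; exists 0. Qed.

Lemma divisor_pair n b : (0 < n)%N -> (b %| n)%N -> (1 < b < n)%N ->
  [/\ n = (n %/ b * b)%N, (1 < n %/ b)%N & (n %/ b + b <= n)%N].
Proof.
move=> n0 bn /andP[b1 bltn]; have nE : n = (n %/ b * b)%N by rewrite divnK.
have d1 : (1 < n %/ b)%N by rewrite ltn_divRL // mul1n.
split=> //; rewrite {2}nE; move: d1 b1; move: (n %/ b)%N => d; clear; nia.
Qed.

Lemma divisor_half n b e : (b %| n)%N -> (b < n)%N -> (n < 2 ^ e.+1)%N -> (b < 2 ^ e)%N.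
Proof.
move=> bn ltbn; rewrite expnS => lt2; have nE : n = (n %/ b * b)%N by rewrite divnK.
move: ltbn lt2; rewrite {1 2}nE; move: (n %/ b)%N (2 ^ e)%N => d E; clear.
case: d => [|[|d]]; rewrite ?mul0n ?mul1n ?ltnn //; nia.
Qed.

(** A proper divisor is at most half of [n], so [m] bounds the depth of the recursion, and the sum
    over divisors matches that defining [tau]. *)
Lemma covered_strict_pair_tau m n : (1 < n)%N -> (n < 2 ^ m.+1)%N ->
  covered (@strict_pair k n) (C * q ^ (n - 2) * tau m n).
Proof.
elim: m n => [|m IH] n n1 ltn; first by move: n1 ltn; rewrite expn1; clear; lia.
have n0 : (0 < n)%N by apply: ltnW.
have cov b : (b %| n)%N -> (b < n)%N -> covered (@capped_pair k b) (capped_bound m b).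
  move=> bn ltbn; rewrite /capped_bound; case: eqP => [->|/eqP b1]; first exact: covered_capped_pair1.
  have b2 : (1 < b)%N by rewrite ltn_neqAle eq_sym b1 (dvdn_gt0 n0).
  apply: covered_capped_pair => //; apply: IH => //; exact: divisor_half ltn.
apply: coveredW (covered_strict_pair n1 cov).
rewrite /= big_distrr /= big_filter [leqLHS]big_mkcond /= big_seq [leqRHS]big_seq.
apply: leq_sum => b; rewrite -dvdn_divisors // => bn; case: ifP => // ltbn.
rewrite /capped_bound; case: eqP => [->|/eqP b1].
  by rewrite divn1 tau1 muln1 mulnC mulnA.
have b2 : (1 < b)%N by rewrite ltn_neqAle eq_sym b1 (dvdn_gt0 n0).
have b2n : (1 < b < n)%N by rewrite b2.
have [nE d2 db] := divisor_pair n0 bn b2n.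
(* With [q.-1 <= q] the exponent is [n %/ b + b - 2], at most [n - 2] for a proper factorization. *)
have key : (q.-1 * q ^ (n %/ b - 2) * (q * q ^ (b - 2)) <= q ^ (n - 2))%N.
  apply: (@leq_trans (q * q ^ (n %/ b - 2) * (q * q ^ (b - 2)))).
    by rewrite !leq_mul2r leq_pred !orbT.
  rewrite -!expnS -expnD leq_pexp2l ?q_gt0 //.
  by move: d2 b2 db; clear; lia.
have -> : (q.-1 * q ^ (n %/ b - 2) * (q * (C * q ^ (b - 2) * tau m b)) =
    C * (q.-1 * q ^ (n %/ b - 2) * (q * q ^ (b - 2))) * tau m b)%N by ring.
by rewrite leq_mul2r leq_mul2l key !orbT.
Qed.

Definition main_count (n : nat) : nat := (q.-1 ^ 3 * q.+1 ^ 2 * q ^ (n + 1))%N.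
Definition error_count (m n : nat) : nat :=
  (\sum_(b <- [seq b <- divisors n | (1 < b < n)%N]) q ^ (n %/ b + b + 6) * tau m b)%N.

(** The 6 is 4 from [(q.+1 * q.-1) ^ 2 <= q ^ 4] plus 2 from [q.-1 ^ 2 <= q ^ 2]; the remaining
    [q ^ 4] cancels the two subtractions of 2. *)
Lemma error_factor n b T : (1 < n %/ b)%N -> (1 < b)%N ->
  (q.+1 * (q.-1 * q ^ (n %/ b - 2) * (q * (C * q ^ (b - 2) * T)))
   <= q ^ (n %/ b + b + 6) * T)%N.
Proof.
move=> d2 b2; rewrite /num_affine.
have -> : (q.+1 * (q.-1 * q ^ (n %/ b - 2) * (q * (q * q.-1 ^ 2 * q.+1 * q ^ 2 * q.-1 * q ^ (b - 2) * T)))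
  = ((q.+1 * q.-1) ^ 2 * q.-1 ^ 2) * (q ^ 4 * q ^ (n %/ b - 2) * q ^ (b - 2)) * T)%N by ring.
rewrite leq_mul2r; apply/orP; right.
have -> : (q ^ (n %/ b + b + 6) = (q ^ 2) ^ 2 * q ^ 2 * (q ^ 4 * q ^ (n %/ b - 2) * q ^ (b - 2)))%N.
  by rewrite -!expnM -!expnD; congr (_ ^ _)%N; move: d2 b2; clear; lia.
rewrite leq_mul2r; apply/orP; right; apply: leq_mul; last by rewrite leq_exp2r // leq_pred.
by rewrite leq_exp2r //; move: q_gt0; clear; case: q => [//|c]; rewrite /= expnS expn1; nia.
Qed.

(** The outermost step is kept apart from [covered_strict_pair_tau]: its term [b = 1] is the main
    count exactly, and the others keep the exponent [n %/ b + b] instead of [n]. *)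
Lemma covered_degree_pair_count m n : (1 < n)%N -> (n < 2 ^ m.+2)%N ->
  covered (@degree_pair k n) (main_count n + error_count m n).
Proof.
move=> n1 ltn; have n0 : (0 < n)%N by apply: ltnW.
have cov b : (b %| n)%N -> (b < n)%N -> covered (@capped_pair k b) (capped_bound m b).
  move=> bn ltbn; rewrite /capped_bound; case: eqP => [->|/eqP b1]; first exact: covered_capped_pair1.
  have b2 : (1 < b)%N by rewrite ltn_neqAle eq_sym b1 (dvdn_gt0 n0).
  apply: covered_capped_pair => //; apply: covered_strict_pair_tau => //; exact: divisor_half ltn.
apply: coveredW (covered_degree_pair n1 (covered_strict_pair n1 cov)).
have r1 : 1%N \in [seq b <- divisors n | (b < n)%N].
  by rewrite mem_filter n1 -dvdn_divisors // dvd1n.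
rewrite (bigD1_seq 1%N r1) ?filter_uniq ?divisors_uniq //= mulnDr.
apply: leq_add.
  rewrite /capped_bound eqxx divn1 /main_count /num_affine.
  have -> : (n + 1 = (n - 2) + 3)%N by move: n1; clear; lia.
  by rewrite expnD; apply/eq_leq; ring.
rewrite big_distrr /= /error_count !big_filter big_filter_cond /=.
rewrite big_mkcond [leqRHS]big_mkcond /= big_seq [leqRHS]big_seq.
apply: leq_sum => b; rewrite -dvdn_divisors // => bn.
case: ifP => // /andP[ltbn b1].
have b2 : (1 < b)%N by rewrite ltn_neqAle eq_sym b1 (dvdn_gt0 n0).
rewrite b2 ltbn /= /capped_bound (negPf b1).
have b2n : (1 < b < n)%N by rewrite b2.
have [_ d2 _] := divisor_pair n0 bn b2n.
exact: error_factor.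
Qed.

Local Open Scope classical_set_scope.
Local Open Scope fset_scope.

Lemma covered_finite_set (T : choiceType) (S : set T) N :
  covered S N -> finite_set S /\ (#|` fset_set S| <= N)%N.
Proof.
move=> [s sN sS].
have fin : finite_set S.
  by apply: (sub_finite_set _ (finite_seq s)) => x Sx; exact: sS.
split=> //; apply: leq_trans sN; apply: uniq_leq_size; first exact: fset_uniq.
by move=> x; rewrite in_fset_set // in_setE => /sS.
Qed.

(** The covering of pairs also yields finiteness, without which [fset_set] would be empty; the
    injective parametrization then gives the lower bound. *)
Lemma count_automorphisms m n : (1 < n)%N -> (n < 2 ^ m.+2)%N ->
  (main_count n <= num_automorphisms k n <= main_count n + error_count m n)%N.
Proof.
move=> n1 ltn; have [s sN sS] := covered_degree_pair_count n1 ltn.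
pose toaut (xy : {mpoly k[2]} * {mpoly k[2]}) := subst2 xy.1 xy.2.
have [fin le] : finite_set (automorphisms_of_degree k n)
    /\ (num_automorphisms k n <= main_count n + error_count m n)%N.
  apply: covered_finite_set; exists (map toaut s); first by rewrite size_map.
  move=> phi [aut degn]; apply/mapP; exists (phi 'X_0, phi 'X_1).
    by apply: sS; split; [exact: automorphism_aut_pair|exact: degn].
  by apply: funext => p; apply: alg_automorphism_subst2 aut erefl erefl p.
rewrite le andbT.
have -> : main_count n = size [seq toaut (param_pair x) | x <- enum (params k n)].
  rewrite size_map -cardE card_params /main_count /num_affine.
  have -> : (n + 1 = (n - 2) + 3)%N by move: n1; clear; lia.
  by rewrite expnD; ring.
have toaut_inj : injective (fun x : params k n => toaut (param_pair x)).
  move=> x y E; apply: (param_pair_inj n1).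
  move: (congr1 (fun f => f 'X_0) E) (congr1 (fun f => f 'X_1) E).
  rewrite /toaut !subst2_0 !subst2_1.
  by case: (param_pair x) (param_pair y) => [X Y] [X' Y'] /= -> ->.
apply: uniq_leq_size; first by rewrite (map_inj_uniq toaut_inj) enum_uniq.
move=> phi /mapP[x _ ->]; rewrite in_fset_set // in_setE.
have [aut deg] := param_pair_T x n1; split; first exact: aut_pair_automorphism.
by rewrite /end_degree /toaut subst2_0 subst2_1.
Qed.

End UpperBound.

End Count.

From mathcomp Require Import reals topology normedtype.
From mathcomp Require Import landau exp sequences.

Module Bounds.
Import JungVanDerKulk Count.
Set Implicit Arguments.
Unset Strict Implicit.
Unset Printing Implicit Defensive.
Import Order.TTheory GRing.Theory Num.Theory.
Import numFieldNormedType.Exports.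
Local Open Scope classical_set_scope.
Local Open Scope ring_scope.

(** * Real estimates of the error term *)

Section Asymptotics.
Variable R : realType.

Lemma ln2_gt0 : 0 < ln 2 :> R.
Proof. by apply: ln_gt0; rewrite ltr1n. Qed.

Lemma log2_ge (e n : nat) : (0 < n)%N -> (2 ^ e <= n)%N -> e%:R <= log2 n%:R :> R.
Proof.
move=> n0 en; rewrite /log2 ler_pdivlMr ?ln2_gt0 // mulr_natl -lnXn //.
by rewrite ler_ln ?posrE ?exprn_gt0 ?ltr0n // -natrX ler_nat.
Qed.

Lemma log2_powR_ge (n e : nat) : (0 < e)%N -> (0 < n)%N -> (2 ^ e <= n)%N ->
  (e ^ e)%:R <= log2 n%:R `^ log2 n%:R :> R.
Proof.
move=> e0 n0 en; have le_log := log2_ge n0 en.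
have log1 : 1 <= log2 n%:R :> R by apply: le_trans le_log; rewrite ler1n.
rewrite natrX -powR_mulrn //; apply: (@le_trans _ _ (log2 n%:R `^ e%:R)).
  by apply: ge0_ler_powR; rewrite ?nnegrE // (le_trans _ log1).
exact: ler_powR.
Qed.

Lemma error_count_le (F : finFieldType) (m n : nat) : (1 < n)%N ->
  (2 ^ m.+1 <= n)%N -> (n < 2 ^ m.+2)%N ->
  (error_count F m n)%:R <= log2 n%:R `^ log2 n%:R * #|F|%:R `^ (n%:R / 2 + 8) :> R.
Proof.
move=> n1 len ltn; have n0 : (0 < n)%N by apply: ltnW.
have q1 : 1 <= #|F|%:R :> R by rewrite ler1n q_gt0.
have q0 : 0 <= #|F|%:R :> R by rewrite ler0n.
(* This is part of the sum defining [ordered_factorizations m.+1 n], which [tau_le] bounds. *)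
have sum_le : (\sum_(b <- [seq b <- divisors n | (1 < b < n)%N])
    ordered_factorizations m b <= m.+1 ^ m.+1)%N.
  have n0ltn : (0 < n < 2 ^ m.+2)%N by rewrite n0.
  apply: leq_trans _ (tau_le n0ltn (ltn0Sn m)) => /=.
  by apply: leq_sum_subset; [rewrite filter_uniq ?divisors_uniq|
    move=> b; rewrite mem_filter => /andP[]].
apply: (@le_trans _ _ ((m.+1 ^ m.+1)%:R * #|F|%:R `^ (n%:R / 2 + 8))); last first.
  by apply: ler_wpM2r; [exact: powR_ge0|exact: log2_powR_ge].
apply: (@le_trans _ _ ((\sum_(b <- [seq b <- divisors n | (1 < b < n)%N])
    ordered_factorizations m b)%:R * #|F|%:R `^ (n%:R / 2 + 8))); last first.
  by apply: ler_wpM2r; [exact: powR_ge0|rewrite ler_nat].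
rewrite /error_count !natr_sum mulr_suml big_seq [leRHS]big_seq.
apply: ler_sum => b; rewrite mem_filter -dvdn_divisors // => /andP[b1n bn].
rewrite natrM [leLHS]mulrC; apply: ler_wpM2l; first exact: ler0n.
rewrite natrX -powR_mulrn //; apply: ler_powR => //.
have [nE d2 _] := divisor_pair n0 bn b1n; have /andP[b2 _] := b1n.
(* With [d = n %/ b], both factors being at least 2, [(d - 2) * (b - 2) >= 0] reads
   [2 * (d + b) <= n + 4]. *)
have : (2 * (n %/ b + b + 6) <= n + 16)%N.
  by rewrite [X in (_ <= X + _)%N]nE; move: d2 b2; move: (n %/ b)%N => d; clear; nia.
rewrite -(ler_nat R) natrM [(n + 16)%:R]natrD => hle.
have two0 : 0 < 2 :> R by rewrite ltr0n.
rewrite -(ler_pM2l two0) mulrDr mulrCA divff ?pnatr_eq0 // mulr1.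
by apply: le_trans hle _; rewrite lerD2l -natrM.
Qed.

(** With [L = log2 n], the left side is [expR (L * ln L)], at most [expR (L ^+ 2)], and [L ^+ 2] is
    of smaller order than [n]. *)
Lemma log2_powR_le_expR (c : R) : 0 < c ->
  \forall n \near \oo, log2 n%:R `^ log2 n%:R <= expR (c * n%:R).
Proof.
move=> c0; pose a := ln 2 : R; have a0 : 0 < a := ln2_gt0.
(* Chosen so that [n >= K ^+ 2], that is [s ^+ 2 >= K] for the fourth root [s] of [n], turns
   [16 / a ^+ 2 * s ^+ 2] into at most [c * n]. *)
pose K := 16 / (a ^+ 2 * c).
near=> n.
have n2 : (2 <= n)%N by near: n; apply: nbhs_infty_ge.
have nK : K ^+ 2 <= n%:R by near: n; apply: nbhs_infty_ger.
have npos : 0 < n%:R :> R by rewrite ltr0n (leq_trans _ n2).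
have log1 : 1 <= log2 n%:R :> R by apply: (@log2_ge 1) => //; apply: leq_trans n2.
have log0 : 0 < log2 n%:R :> R by apply: lt_le_trans log1.
rewrite /powR gt_eqF // ler_expR.
apply: (@le_trans _ _ (log2 n%:R ^+ 2)).
  by rewrite expr2; apply: ler_wpM2l; [exact: ltW|exact/ltW/ln_sublinear].
pose s := n%:R `^ (4^-1) : R.
have s0 : 0 < s by apply: powR_gt0.
(* [ln n = 4 ln (n^(1/4)) <= 4 n^(1/4)] makes [(log2 n)^2] of order [sqrt n]. *)
have lns : ln n%:R <= 4 * s.
  have -> : ln n%:R = 4 * ln s :> R by rewrite ln_powR mulrA divff ?mul1r ?pnatr_eq0.
  by apply: ler_wpM2l => //; apply/ltW/ln_sublinear.
have s4 : s ^+ 4 = n%:R.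
  by rewrite -powR_mulrn ?ltW // -powRrM mulVf ?pnatr_eq0 // powRr1 ?ltW.
have sK : K <= s ^+ 2.
  have K0 : 0 <= K by rewrite divr_ge0 // mulr_ge0 ?exprn_ge0 // ltW.
  have K2 : K ^+ 2 <= (s ^+ 2) ^+ 2 by rewrite -exprM s4.
  by move: K2; rewrite ler_pXn2r ?nnegrE ?exprn_ge0 // ltW.
have ln0 : 0 <= ln n%:R :> R by apply: ln_ge0; rewrite ler1n (leq_trans _ n2).
have : log2 n%:R ^+ 2 <= 16 / a ^+ 2 * s ^+ 2.
  rewrite /log2 -/a expr_div_n [leRHS]mulrAC ler_pM2r ?invr_gt0 ?exprn_gt0 //.
  have -> : 16 * s ^+ 2 = (4 * s) ^+ 2 :> R by rewrite exprMn -natrX.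
  by rewrite ler_pXn2r ?nnegrE ?mulr_ge0 // ltW.
move=> /le_trans; apply.
have -> : 16 / a ^+ 2 = K * c.
  by rewrite /K; field; rewrite !gt_eqF.
rewrite -s4 (_ : c * s ^+ 4 = s ^+ 2 * c * s ^+ 2); last by ring.
apply: ler_wpM2r; first by rewrite exprn_ge0 // ltW.
by apply: ler_wpM2r => //; apply: ltW.
Unshelve. all: by end_near. Qed.

End Asymptotics.

End Bounds.

Import Order.TTheory GRing.Theory Num.Theory.
Import numFieldNormedType.Exports.
Import JungVanDerKulk Count Bounds.
Local Open Scope classical_set_scope.
Local Open Scope ring_scope.

Theorem theorem2p3 (R : realType) (F : finFieldType) (q : nat)
    (Fq : #|F| = q) :
  let p (n : nat) : R := (num_automorphisms F n)%:R in
  let main (n : nat) : R :=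
    (q%:R - 1) ^+ 3 * (q%:R + 1) ^+ 2 * q%:R ^+ (n + 1) in
  (forall n : nat, (2 <= n)%N ->
     main n <= p n /\
     p n <= main n
            + log2 n%:R `^ log2 n%:R * q%:R `^ (n%:R / 2 + 8)) /\
  (forall eps : R, 0 < eps ->
     p = main +O_\oo (fun n : nat => q%:R `^ (n%:R * (1 / 2 + eps)))).
Proof.
move=> p main.
have q1 : (1 < q)%N by rewrite -Fq card_finNzRing_gt1.
have q0 : 0 < q%:R :> R by rewrite ltr0n ltnW.
have mainE n : main n = (main_count F n)%:R.
  rewrite /main_count Fq /main !natrM !natrX -natr1; congr (_ ^+ 3 * _ * _).
  by rewrite -subn1 natrB // ltnW.
have bounds n : (2 <= n)%N -> main n <= p n /\
    p n <= main n + log2 n%:R `^ log2 n%:R * q%:R `^ (n%:R / 2 + 8).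
  move=> n2; have n0 : (0 < n)%N by apply: ltnW.
  have /andP[len ltn] := @trunc_log_bounds 2 n isT n0.
  have L0 : (0 < trunc_log 2 n)%N by rewrite trunc_log_gt0.
  (* The outermost step of the recursion is not counted in [m], so [m] is one less than
     [trunc_log 2 n]. *)
  rewrite -(prednK L0) in len ltn.
  have /andP[lo hi] := count_automorphisms F n2 ltn.
  rewrite mainE !ler_nat; split=> //; apply: (le_trans (_ : p n <= (_ + _)%:R)).
    by rewrite ler_nat; exact: hi.
  by rewrite natrD lerD2l -Fq; apply: error_count_le.
split=> // eps eps0; apply/eqaddOP.
have lnq : 0 < ln q%:R :> R by apply: ln_gt0; rewrite ltr1n.
near=> K; near=> n.
have n2 : (2 <= n)%N by near: n; apply: nbhs_infty_ge.
have logn : log2 n%:R `^ log2 n%:R <= expR (eps * ln q%:R * n%:R) :> R.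
  by near: n; apply: log2_powR_le_expR; rewrite mulr_gt0.
(* The factor [q ^ 8] of the error term becomes the implied constant, and the logarithmic factor is
   absorbed into [q] to the power [eps * n]. *)
have Kq : q%:R ^+ 8 <= K by near: K; apply: nbhs_pinfty_ge; rewrite num_real.
have [lo hi] := bounds n n2.
have -> : (p - main) n = p n - main n by [].
rewrite ger0_norm ?subr_ge0 // ger0_norm ?powR_ge0 // lerBlDl.
apply: le_trans hi _; rewrite lerD2l.
apply: (@le_trans _ _ (q%:R ^+ 8 * q%:R `^ (n%:R * (1 / 2 + eps)))); last first.
  by apply: ler_wpM2r => //; apply: powR_ge0.
have -> : q%:R ^+ 8 * q%:R `^ (n%:R * (1 / 2 + eps)) =
    expR (eps * ln q%:R * n%:R) * q%:R `^ (n%:R / 2 + 8) :> R.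
  rewrite -powR_mulrn ?(ltW q0) // /powR !gt_eqF // -!expRD; congr expR.
  by field.
by apply: ler_wpM2r => //; apply: powR_ge0.
Unshelve. all: by end_near. Qed.
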